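(* Let $p$ be a prime with $p\equiv -3\pmod 8$, let $s\ge 1$, $q=p^s$, and let $m\ge 2$ be an integer with $2^{m}\mid(q-1)$ but $2^{m+1}\nmid(q-1)$. Let $n\ge 1$ and let $N$ be the number of $(x_1,\dots,x_n)\in\mathbb F_q^n$ with $x_1^{2^m}+\dots+x_n^{2^m}=0$. For $r=1,2,\dots,m-1$ let $C_r,D_r$ be integers with $$p^{s/2^{r-1}}=C_r^2+D_r^2,\qquad C_r\equiv -1\pmod 4,\qquad p\nmid C_r.$$ If $m=2$ then \begin{align*} N=\,&q^{n-1}+\frac{q-1}{4q}\Bigl[\Bigl(-q^{\frac12}+q^{\frac14}i\sqrt{2(q^{\frac12}+C_1)}\,\Bigr)^n+\Bigl(-q^{\frac12}-q^{\frac14}i\sqrt{2(q^{\frac12}+C_1)}\,\Bigr)^n\\ &+\Bigl(q^{\frac12}+q^{\frac14}i\sqrt{2(q^{\frac12}-C_1)}\,\Bigr)^n+\Bigl(q^{\frac12}-q^{\frac14}i\sqrt{2(q^{\frac12}-C_1)}\,\Bigr)^n\Bigr]. \end{align*} If $m\ge 3$ then, writing $P=-q^{\frac 12}+\sum_{r=2}^{m-2}2^{r-1}C_r q^{\frac{2^{r-1}-1}{2^{r}}}$, \begin{align*} N=\,&q^{n-1}+\frac{q-1}{2^mq}\cdot\Bigl[2^{m-2}\cdot\Bigl((q^{\frac12}+2D_2q^{\frac14})^n+(q^{\frac12}-2D_2q^{\frac14})^n\Bigr)\\ &+\sum_{t=1}^{m-3}2^{m-t-2}\Bigl((-q^{\frac12}+\sum_{r=2}^t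 2^{r-1}C_rq^{\frac{2^{r-1}-1}{2^{r}}}-2^t C_{t+1}q^{\frac{2^{t}-1}{2^{t+1}}}+2^{t+1} D_{t+2}q^{\frac{2^{t+1}-1}{2^{t+2}}})^n\\ &\qquad+(-q^{\frac12}+\sum_{r=2}^t 2^{r-1}C_rq^{\frac{2^{r-1}-1}{2^{r}}}-2^t C_{t+1}q^{\frac{2^{t}-1}{2^{t+1}}}-2^{t+1} D_{t+2}q^{\frac{2^{t+1}-1}{2^{t+2}}})^n\Bigr)\\ &+\Bigl(P+2^{m-2}C_{m-1} q^{\frac{2^{m-2}-1}{2^{m-1}}}+2^{m-2}q^{\frac{2^{m-1}-1}{2^{m}}}i\sqrt{2(q^{\frac1{2^{m-1}}}-C_{m-1})}\,\Bigr)^n\\ &+\Bigl(P+2^{m-2}C_{m-1} q^{\frac{2^{m-2}-1}{2^{m-1}}}-2^{m-2}q^{\frac{2^{m-1}-1}{2^{m}}}i\sqrt{2(q^{\frac1{2^{m-1}}}-C_{m-1})}\,\Bigr)^n\\ &+\Bigl(P-2^{m-2}C_{m-1} q^{\frac{2^{m-2}-1}{2^{m-1}}}+2^{m-2}q^{\frac{2^{m-1}-1}{2^{m}}}i\sqrt{2(q^{\frac1{2^{m-1}}}+C_{m-1})}\,\Bigr)^n\\ &+\Bigl(P-2^{m-2}C_{m-1} q^{\frac{2^{m-2}-1}{2^{m-1}}}-2^{m-2}q^{\frac{2^{m-1}-1}{2^{m}}}i\sqrt{2(q^{\frac1{2^{m-1}}}+C_{m-1})}\,\Bigr)^n\Bigr].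 \end{align*}
   Context: Here $i=\sqrt{-1}$. Powers $q^{a}$ with rational $a$ denote positive real powers, and $\sqrt{\cdot}$ is the nonnegative real square root (the radicands are positive). Empty sums are zero. Under the hypotheses, $2^{m-2}\mid s$, so $p^{s/2^{r-1}}$ is an integer for $r\le m-1$; the conditions determine $C_r$ uniquely and $D_r$ up to sign, and the formula holds for either choice of signs. *)

(* Defs.v *)
From mathcomp Require Import all_boot all_order all_algebra.
From mathcomp Require Import algC.
Set Implicit Arguments. Unset Strict Implicit. Unset Printing Implicit Defensive.
Import Order.TTheory GRing.Theory Num.Theory.
Local Open Scope ring_scope.

(* qpow x k d = x^(k/d), the nonnegative real d-th root of x^k in algC
   (for x >= 0 real this is the positive real power). *)
Definition qpow (x : algC) (k d : nat) : algC := d.-root (x ^+ k).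

Definition Nsol (F : finFieldType) (n m : nat) : nat :=
  #|[set x : {ffun 'I_n -> F} | \sum_(i < n) x i ^+ (2 ^ m) == 0]|.

(* Main.v *)
Require Import Defs.
From mathcomp Require Import all_boot all_order all_algebra.
From mathcomp Require Import algC.
From mathcomp Require Import all_field cyclic zify ring.
Set Implicit Arguments. Unset Strict Implicit. Unset Printing Implicit Defensive.
Import Order.TTheory GRing.Theory Num.Theory.
Local Open Scope ring_scope.

(** Let [g] generate the unit group of [F], let [psi] be an additive character
    invariant under Frobenius, and let [chi] be a multiplicative character of
    order [2 ^ m].  Then [q N = q ^ n + (q - 1) / 2 ^ m * sum_(j < 2 ^ m) S_j ^ n]
    with [S_j = sum_x psi (g ^ j x ^ (2 ^ m))], and [S_j] is a combination of the
    Gauss sums [G (chi ^ k)].  As [p = 5 mod 8] generates the residues congruent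
    to 1 mod 4 modulo [2 ^ m], Frobenius leaves only the Gauss sums
    [G_r = G (chi ^ (2 ^ (m - r)))] and their conjugates.  Up to a factor [i] when
    [r = m], [c_r] and [d_r] are the real and imaginary parts of [G_r], and
    [S_j] equals [c_1 + 2 c_2 + ... + 2 ^ (t-1) c_t - 2 ^ t c_(t+1) +- 2 ^ (t+1) d_(t+2)]
    for [j] of 2-adic valuation [t].

    The product formula for the quadratic character gives
    [G_r ^ 2 = +- G_1 G_(r-1)] for [r >= 3], while [G_2 ^ 2 = J G_1] with a quartic
    Jacobi sum [J]; a binomial coefficient modulo [p] shows that [p] does not divide
    [Re J].  Hence [c_r ^ 2] and [d_r ^ 2] are determined recursively, and
    uniqueness of [p ^ k = C ^ 2 + D ^ 2] with [p] not dividing [C] identifies them.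
    The signs come from [S_j = 1 mod 2 ^ m], which forces [c_r = -1 mod 2 ^ (m - r)];
    the sign of [c_(m-1)] stays open, but the formula is symmetric in it. *)

(** * Additive characters *)

Section AdditiveCharacter.
Variables (F : finFieldType) (p s : nat).
Hypotheses (p_pr : prime p) (cardF : #|F| = (p ^ s)%N).

Let charFp : p \in [pchar F] := card_finPcharP cardF p_pr.

Let s_gt0 : (0 < s)%N.
Proof. by case: s cardF (finNzRing_gt1 F) => // ->. Qed.

Definition fftrace (x : F) := \sum_(i < s) x ^+ (p ^ i).

Let expD x y i : (x + y) ^+ (p ^ i) = x ^+ (p ^ i) + y ^+ (p ^ i) :> F.
Proof. by apply: exprDn_pchar; rewrite (eq_pnat _ (pcharf_eq charFp)) pnatX pnat_id. Qed.

Lemma fftraceD x y : fftrace (x + y) = fftrace x + fftrace y.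
Proof. by rewrite -big_split; apply: eq_bigr => i _; rewrite expD. Qed.

Lemma fftrace_frobenius x : fftrace (x ^+ p) = fftrace x.
Proof.
rewrite /fftrace; case: s s_gt0 cardF => // n _ cF.
rewrite big_ord_recr big_ord_recl /= -exprM -expnS -cF expf_card addrC.
congr (_ + _); apply: eq_bigr => i _; by rewrite -exprM -expnS.
Qed.

(** Raising to the power [p] is additive, so it passes through the sum and turns the trace of [x]
    into that of [x ^+ p]. *)
Lemma fftraceX x : fftrace x ^+ p = fftrace x.
Proof.
rewrite -[in RHS]fftrace_frobenius /fftrace.
elim: s => [|n IHn]; first by rewrite !big_ord0 expr0n gtn_eqF ?prime_gt0.
have := expD (\sum_(i < n) x ^+ (p ^ i)) (x ^+ (p ^ n)) 1; rewrite !expn1 IHn => E.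
by rewrite !big_ord_recr /= E -!exprM mulnC.
Qed.

Let natr_eq_mod k l : (k%:R == l%:R :> F) = (k == l %[mod p]).
Proof.
wlog le_lk: k l / (l <= k)%N.
  by move=> W; case/orP: (leq_total l k) => /W // E; rewrite eq_sym E eq_sym.
by rewrite eqn_mod_dvd // (dvdn_pcharf charFp) natrB // subr_eq0.
Qed.

(** The polynomial X^p - X has at most [p] roots, and the [p] distinct multiples of 1 already are
    roots; another root [y] would be one too many. *)
Lemma prime_subfieldP (y : F) : y ^+ p = y -> exists2 k, (k < p)%N & y = k%:R.
Proof.
move=> yp; have p1 := prime_gt1 p_pr.
pose rs : seq F := [seq k%:R | k <- iota 0 p].
have [/mapP[k]|yrs] := boolP (y \in rs).
  by rewrite mem_iota => /andP[_ kp] ->; exists k.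
have szp : size ('X^p - 'X : {poly F}) = p.+1.
  by rewrite size_polyDl size_polyXn // size_polyN size_polyX.
have: ('X^p - 'X : {poly F}) != 0 by rewrite -size_poly_eq0 szp.
move/max_poly_roots => /(_ (y :: rs)); rewrite szp /= size_map size_iota ltnn.
move=> H; suff: false by []; apply: H.
  apply/andP; split; first by rewrite /root !hornerE yp subrr.
  apply/allP=> _ /mapP[k _ ->]; rewrite /root !hornerE.
  by rewrite -[k%:R ^+ p](pFrobenius_autE charFp) pFrobenius_aut_nat subrr.
rewrite yrs map_inj_in_uniq ?iota_uniq // => i j; rewrite !mem_iota /= add0n.
by move=> ip jp /eqP; rewrite natr_eq_mod !modn_small // => /eqP.
Qed.

(** The trace is a polynomial map of degree p^(s-1), too small for all p^s elements to be roots. *)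
Lemma fftrace_neq0 : exists x, fftrace x != 0.
Proof.
apply/existsP; apply: contraT; rewrite negb_exists => /forallP tr0.
pose P : {poly F} := \sum_(i < s) 'X^(p ^ i).
have PE x : P.[x] = fftrace x.
  by rewrite /P horner_sum; apply: eq_bigr => i _; rewrite hornerXn.
have szP : size P = (p ^ s.-1).+1.
  rewrite /P; case: s s_gt0 => // n _; rewrite big_ord_recr /= addrC size_polyDl size_polyXn //.
  apply: (leq_ltn_trans (size_sum _ _ _)); rewrite ltnS.
  by apply/bigmax_leqP => i _; rewrite size_polyXn ltn_exp2l ?prime_gt1.
have P0 : P != 0 by rewrite -size_poly_eq0 szP.
have := max_poly_roots P0 _ (enum_uniq F); rewrite szP -cardE cardF => H.
suff: (p ^ s < (p ^ s.-1).+1)%N by rewrite ltnS leq_exp2l ?prime_gt1 // ; lia.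
by apply: H; apply/allP => x _; rewrite /root PE; move: (tr0 x); rewrite negbK.
Qed.

(** The character is w^Tr(x) with [w] a primitive p-th root of unity. Its Frobenius invariance will
    identify Gauss sums of conjugate characters; its values are roots of unity, hence algebraic
    integers. *)
Lemma frobenius_additive_character :
  exists psi : F -> algC,
    [/\ {morph psi : x y / x + y >-> x * y}, exists x, psi x != 1,
        forall x, psi (x ^+ p) = psi x & forall x, psi x ^+ p = 1].
Proof.
have [w pw] := C_prim_root_exists (prime_gt0 p_pr).
have kP x : exists k, fftrace x == k%:R.
  by have [k _ ->] := prime_subfieldP (fftraceX x); exists k.
pose lg x := xchoose (kP x).
have lgP x : fftrace x = (lg x)%:R by apply/eqP/(xchooseP (kP x)).
clearbody lg; pose psi x := w ^+ lg x.
have psiE x k : fftrace x = k%:R -> psi x = w ^+ k.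
  by move=> E; apply/eqP; rewrite (eq_prim_root_expr pw) -natr_eq_mod -lgP E.
exists psi; split.
- by move=> x y; rewrite -exprD; apply: psiE; rewrite fftraceD natrD !lgP.
- have [x nz] := fftrace_neq0; exists x; rewrite /psi -(prim_order_dvd pw).
  by rewrite (dvdn_pcharf charFp) -lgP.
- by move=> x; apply: psiE; rewrite fftrace_frobenius lgP.
- by move=> x; rewrite /psi exprAC (prim_expr_order pw) expr1n.
Qed.

End AdditiveCharacter.

(** * The unit group of a finite field *)

Lemma big_ord_mul (V : nmodType) (f : nat -> V) (d e : nat) :
  \sum_(i < d * e) f i = \sum_(a < e) \sum_(b < d) f (d * a + b)%N.
Proof.
elim: e => [|e IHe]; first by rewrite muln0 !big_ord0.
by rewrite mulnSr big_split_ord /= IHe big_ord_recr.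
Qed.

Lemma sum_prim_root_expr (R : idomainType) (d : nat) (z : R) (b : nat) :
  d.-primitive_root z ->
  \sum_(k < d) (z ^+ b) ^+ k = if (d %| b)%N then d%:R else 0.
Proof.
move=> pz; case: ifPn => db.
  have -> : z ^+ b = 1 by apply/eqP; rewrite -(prim_order_dvd pz).
  by under eq_bigr do rewrite expr1n; rewrite sumr_const card_ord.
have: (z ^+ b) ^+ d - 1 = 0 by rewrite exprAC (prim_expr_order pz) expr1n subrr.
rewrite subrX1 => /eqP; rewrite mulf_eq0 subr_eq0 -(prim_order_dvd pz) (negPf db).
by move/eqP.
Qed.

Section FiniteFieldUnits.
Variable F : finFieldType.

Lemma finField_prim_root : exists g : F, #|F|.-1.-primitive_root g.
Proof.
have F1 : (0 < #|F|.-1)%N by case: #|F| (finNzRing_gt1 F) => [|[]].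
have := @has_prim_root _ _ [seq x : F <- enum F | x != 0] F1.
case/(_ _ _ _)/hasP => [||| g _ pg]; last by exists g.
- apply/allP=> x; rewrite mem_filter => /andP[x0 _].
  apply/unity_rootP/(mulfI x0); rewrite -exprS prednK ?expf_card ?mulr1 //.
  exact: ltnW (finNzRing_gt1 F).
- exact/filter_uniq/enum_uniq.
- rewrite (_ : filter _ _ = enum (predC1 (0 : F))) -?cardE ?cardC1 //.
  by rewrite enumT /enum_mem; apply: eq_filter.
Qed.

Variable g : F.
Hypothesis g_prim : #|F|.-1.-primitive_root g.

Let q_gt1 : (1 < #|F|)%N := finNzRing_gt1 F.
Let q1_gt0 : (0 < #|F|.-1)%N. Proof. by case: #|F| q_gt1 => [|[]]. Qed.

Lemma gen_neq0 : g != 0.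
Proof.
by apply: contraTneq g_prim => ->; rewrite /primitive_root_of_unity; apply/negP =>
  /prim_expr_order/eqP; rewrite expr0n gtn_eqF // eq_sym oner_eq0.
Qed.

Lemma gen_logP (x : F) : x != 0 -> exists i, x = g ^+ i.
Proof.
move=> x0; have: x ^+ #|F|.-1 = 1.
  by apply: (mulfI x0); rewrite -exprS prednK ?expf_card ?mulr1 // ltnW.
by case/(prim_rootP g_prim) => i ->; exists i.
Qed.

Lemma sum_gen (V : nmodType) (f : F -> V) :
  \sum_(x | x != 0) f x = \sum_(i < #|F|.-1) f (g ^+ i).
Proof.
rewrite -(big_imset f (h := fun i : 'I_#|F|.-1 => g ^+ i)) /=; last first.
  move=> i j _ _ /eqP; rewrite (eq_prim_root_expr g_prim) !modn_small //.
  by move/eqP/val_inj.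
apply: eq_bigl => x; apply/idP/imsetP => [x0|[i _ ->]]; last by rewrite expf_neq0 ?gen_neq0.
have: x ^+ #|F|.-1 = 1.
  by apply: (mulfI x0); rewrite -exprS prednK ?expf_card ?mulr1 // ltnW.
by case/(prim_rootP g_prim) => i ->; exists i.
Qed.

Lemma sum_gen_expr (V : nmodType) (f : F -> V) (d : nat) : (d %| #|F|.-1)%N ->
  \sum_(x | x != 0) f (x ^+ d) = (\sum_(i < #|F|.-1 %/ d) f (g ^+ (d * i))) *+ d.
Proof.
move=> dq; have d0 : (0 < d)%N by apply: dvdn_gt0 dq.
case/dvdnP: (dq) => e E; rewrite sum_gen E mulnK //.
rewrite (big_ord_mul (fun i => f ((g ^+ i) ^+ d))).
rewrite -[X in _ *+ X](card_ord d) -sumr_const; apply: eq_bigr => a _.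
apply: eq_bigr => b _; congr f; rewrite -exprM mulnDl exprD mulnAC -E.
by rewrite exprM (prim_expr_order g_prim) expr1n mul1r mulnC.
Qed.

(** On units the inner sum over [k] is [d] at d-th powers and 0 elsewhere, and every d-th power has
    exactly [d] roots. *)
Lemma sum_expr_character (f : F -> algC) (d : nat) (chi : F -> algC) :
    (d %| #|F|.-1)%N -> d.-primitive_root (chi g) ->
    (forall i, chi (g ^+ i) = chi g ^+ i) ->
  \sum_(x | x != 0) f (x ^+ d) = \sum_(x | x != 0) f x * \sum_(k < d) chi x ^+ k.
Proof.
move=> dq pz chiX; have d0 : (0 < d)%N := prim_order_gt0 pz.
rewrite sum_gen_expr // sum_gen; case/dvdnP: (dq) => e E; rewrite E mulnK // mulnC.
rewrite (big_ord_mul (fun i => f (g ^+ i) * \sum_(k < d) chi (g ^+ i) ^+ k)).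
rewrite -sumrMnl; apply: eq_bigr => a _; case: d dq pz d0 E => // d dq pz _ _.
rewrite big_ord_recl [X in _ + X]big1 => [|b _]; rewrite /= chiX (sum_prim_root_expr _ pz).
  by rewrite addn0 dvdn_mulr // addr0 mulr_natr.
by rewrite dvdn_addr ?dvdn_mulr // gtnNdvd ?mulr0 // /bump add1n ltnS.
Qed.

(** The character sends g^i to zeta^i, which is well defined because [n] divides the order of
    [g]. *)
Lemma log_character (n : nat) (zeta : algC) :
    (n %| #|F|.-1)%N -> n.-primitive_root zeta ->
  exists chi : F -> algC,
    [/\ chi 0 = 0, chi g = zeta & {morph chi : x y / x * y}].
Proof.
move=> nq pz; have kP x : exists i, (x == 0) || (x == g ^+ i).
  have [->|/gen_logP[i ->]] := eqVneq x 0; first by exists 0%N; rewrite ?eqxx.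
  by exists i; rewrite eqxx orbT.
pose lg x := xchoose (kP x).
have lgP x : x != 0 -> x = g ^+ lg x.
  by move=> /negPf x0; case/orP: (xchooseP (kP x)) => /eqP // /eqP; rewrite x0.
have E i j : g ^+ i = g ^+ j -> zeta ^+ i = zeta ^+ j.
  move/eqP; rewrite (eq_prim_root_expr g_prim) => /eqP e.
  apply/eqP; rewrite (eq_prim_root_expr pz).
  by rewrite -(modn_dvdm i nq) -(modn_dvdm j nq) e.
exists (fun x => if x == 0 then 0 else zeta ^+ lg x); split; first by rewrite eqxx.
  by rewrite (negPf gen_neq0) -[RHS]expr1; apply: E; rewrite -lgP ?gen_neq0.
move=> x y; rewrite mulf_eq0; case: eqVneq => x0; first by rewrite mul0r.
case: eqVneq => y0; first by rewrite mulr0.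
by rewrite -exprD; apply: E; rewrite exprD -!lgP // mulf_neq0.
Qed.
End FiniteFieldUnits.

(** * Gauss and Jacobi sums *)

Section GaussSums.
Variables (F : finFieldType) (n : nat) (g : F) (zeta : algC).
Variables (psi chi : F -> algC).
Hypothesis g_prim : #|F|.-1.-primitive_root g.
Hypothesis n_dvd : (n %| #|F|.-1)%N.
Hypothesis zeta_prim : n.-primitive_root zeta.
Hypothesis psi0 : psi 0 = 1.
Hypothesis psiD : {morph psi : x y / x + y >-> x * y}.
Hypothesis psi_nontrivial : exists x, psi x != 1.
Hypothesis psiN : forall x, psi (- x) = (psi x)^*.
Hypothesis chi0 : chi 0 = 0.
Hypothesis chi_gen : chi g = zeta.
Hypothesis chiM : {morph chi : x y / x * y}.

Local Notation q := (#|F|%:R : algC).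

Let n_gt0 : (0 < n)%N := prim_order_gt0 zeta_prim.

Let zeta_neq0 : zeta != 0.
Proof.
apply/eqP=> z0; have /eqP := prim_expr_order zeta_prim.
by rewrite z0 expr0n gtn_eqF // eq_sym oner_eq0.
Qed.

Lemma chi1 : chi 1 = 1.
Proof. by apply: (mulfI zeta_neq0); rewrite -chi_gen -chiM !mulr1. Qed.

Lemma chi_genX i : chi (g ^+ i) = zeta ^+ i.
Proof. by elim: i => [|i IHi]; rewrite ?expr0 ?chi1 // !exprS chiM IHi chi_gen. Qed.

Lemma chi_neq0 x : x != 0 -> chi x != 0.
Proof. by case/(gen_logP g_prim) => i ->; rewrite chi_genX expf_neq0. Qed.

Lemma chi_unity x : x != 0 -> chi x ^+ n = 1.
Proof.
case/(gen_logP g_prim) => i ->; rewrite chi_genX exprAC.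
by rewrite (prim_expr_order zeta_prim) expr1n.
Qed.

Lemma chiX x k : (0 < k)%N -> chi (x ^+ k) = chi x ^+ k.
Proof.
case: k => // k _; elim: k => [|k IHk]; first by rewrite !expr1.
by rewrite exprS chiM IHk [in RHS]exprS.
Qed.

(** Nonzero values have modulus 1; at 0 the convention that the inverse of 0 is 0 makes both sides
    vanish. *)
Lemma conj_chi x : (chi x)^* = (chi x)^-1.
Proof.
have [->|x0] := eqVneq x 0; first by rewrite chi0 rmorph0 invr0.
have: `|chi x| ^+ n == 1 by rewrite -normrX chi_unity // normr1.
rewrite pexpr_eq1 // invC_norm => /eqP ->; by rewrite expr1n invr1 mul1r.
Qed.

Lemma sum_psi c : \sum_x psi (c * x) = if c == 0 then q else 0.
Proof.
case: eqVneq => [->|c0].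
  by under eq_bigr do rewrite mul0r psi0; rewrite sumr_const.
have <- : \sum_x psi x = \sum_x psi (c * x) by rewrite (reindex_inj (mulfI c0)).
have [y y1] := psi_nontrivial.
have: (psi y - 1) * \sum_x psi x = 0.
  rewrite mulrBl mul1r mulr_sumr; apply/eqP; rewrite subr_eq0; apply/eqP.
  by rewrite [RHS](reindex_inj (addrI y)) /=; apply: eq_bigr => x _; rewrite psiD.
by move/eqP; rewrite mulf_eq0 subr_eq0 (negPf y1) => /eqP.
Qed.

Lemma sum_chiX k : ~~ (n %| k)%N -> \sum_x chi x ^+ k = 0.
Proof.
move=> nk; have: (zeta ^+ k - 1) * \sum_x chi x ^+ k = 0.
  rewrite mulrBl mul1r mulr_sumr; apply/eqP; rewrite subr_eq0; apply/eqP.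
  rewrite [RHS](reindex_inj (mulfI (gen_neq0 g_prim))) /=; apply: eq_bigr => x _.
  by rewrite chiM exprMn chi_gen.
by move/eqP; rewrite mulf_eq0 subr_eq0 -(prim_order_dvd zeta_prim) (negPf nk) => /eqP.
Qed.

(** Since [chi 0 ^+ 0 = 1], the exponent 0 gives the constant function 1, at 0 too. Hence the
    positivity conditions on exponents below: they force the value 0 at 0. *)
Definition gauss k : algC := \sum_x chi x ^+ k * psi x.
Definition jacobi k l : algC := \sum_x chi x ^+ k * chi (1 - x) ^+ l.

Lemma gauss_mod k l : (0 < k)%N -> (0 < l)%N -> k = l %[mod n] -> gauss k = gauss l.
Proof.
move=> k0 l0 kl; apply: eq_bigr => x _; congr (_ * _).
have [->|/(gen_logP g_prim)[i ->]] := eqVneq x 0.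
  by rewrite chi0 !expr0n !gtn_eqF.
rewrite chi_genX !(exprAC _ i) -(prim_expr_mod zeta_prim k) kl.
by rewrite (prim_expr_mod zeta_prim).
Qed.

Lemma gauss_shift a k : a != 0 ->
  \sum_x chi x ^+ k * psi (a * x) = chi a ^- k * gauss k.
Proof.
move=> a0; rewrite [in RHS]/gauss [in RHS](reindex_inj (mulfI a0)) mulr_sumr.
apply: eq_bigr => x _; rewrite chiM exprMn !mulrA mulVf ?mul1r //.
by rewrite expf_neq0 ?chi_neq0.
Qed.

Lemma jacobiC k l : jacobi k l = jacobi l k.
Proof.
have inj : injective (fun x : F => 1 - x) by move=> x y /addrI/oppr_inj.
rewrite /jacobi (reindex_inj inj); apply: eq_bigr => x _.
by rewrite mulrC subKr.
Qed.

(** Collect the double sum by z = x + y. The part with z = 0 is a multiple of the sum of the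
    nontrivial character chi^(k+l) and vanishes; for z nonzero, scaling x by z produces the Jacobi
    sum. *)
Lemma gaussM k l : (0 < k)%N -> (0 < l)%N -> ~~ (n %| k + l)%N ->
  gauss k * gauss l = jacobi k l * gauss (k + l).
Proof.
move=> k0 l0 nkl; rewrite {1 2}/gauss big_distrlr /=.
have -> : \sum_x \sum_y chi x ^+ k * psi x * (chi y ^+ l * psi y) =
    \sum_z psi z * \sum_x chi x ^+ k * chi (z - x) ^+ l.
  under [RHS]eq_bigr do rewrite mulr_sumr.
  rewrite [RHS]exchange_big; apply: eq_bigr => x _ /=.
  rewrite [RHS](reindex_inj (addrI x)) /=; apply: eq_bigr => y _.
  by rewrite psiD [x + y]addrC addrK; ring.
rewrite /gauss mulr_sumr; apply: eq_bigr => z _; rewrite mulrC mulrA; congr (_ * _).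
have [->|z0] := eqVneq z 0.
  rewrite chi0 [RHS]mulrC expr0n addn_eq0 !gtn_eqF // mul0r.
  transitivity (chi (- 1) ^+ l * \sum_x chi x ^+ (k + l)); last by rewrite sum_chiX ?mulr0.
  rewrite mulr_sumr.
  by apply: eq_bigr => x _; rewrite sub0r -[- x]mulN1r chiM exprMn exprD mulrCA.
rewrite /jacobi mulr_suml (reindex_inj (mulfI z0)); apply: eq_bigr => x _ /=.
by rewrite -{2}[z]mulr1 -mulrBr !chiM !exprMn exprD mulrACA [RHS]mulrC.
Qed.

Lemma gauss_norm k : ~~ (n %| k)%N -> gauss k * (gauss k)^* = q.
Proof.
move=> nk; have k0 : (0 < k)%N by case: k nk; rewrite ?dvdn0.
rewrite {2}/gauss rmorph_sum mulr_sumr /=.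
(* Scaling the variable of the first Gauss sum by [y] gives the double sum over nonzero [y]; the
   term y = 0 is added and subtracted so that [sum_psi] applies and leaves only t = 1. *)
have -> : \sum_y gauss k * (chi y ^+ k * psi y)^* =
    \sum_y \sum_t chi t ^+ k * psi (y * (t - 1)) - \sum_t chi t ^+ k.
  rewrite (bigD1 0) //= [in RHS](bigD1 0) //=.
  rewrite chi0 expr0n gtn_eqF // mul0r rmorph0 mulr0 add0r.
  under [X in _ = X + _ - _]eq_bigr do rewrite mul0r psi0 mulr1.
  rewrite [in RHS]addrC addKr; apply: eq_bigr => y y0.
  rewrite /gauss (reindex_inj (mulfI y0)) mulr_suml; apply: eq_bigr => t _ /=.
  rewrite mulrBr mulr1 psiD psiN rmorphM rmorphXn /= conj_chi chiM exprMn exprVn.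
  have := expf_neq0 k (chi_neq0 y0) => h.
  by rewrite -[RHS](mulr1) -(mulfV h); ring.
rewrite sum_chiX // subr0 exchange_big (bigD1 1) //= [X in _ + X]big1 => [|t t1].
  by under eq_bigr do rewrite subrr mulr0 psi0 mulr1; rewrite sumr_const chi1 expr1n addr0.
under eq_bigr do rewrite [_ * (_ - _)]mulrC.
by rewrite -mulr_sumr sum_psi subr_eq0 (negPf t1) mulr0.
Qed.

Lemma gauss_conj k l : (0 < k)%N -> (0 < l)%N -> (n %| k + l)%N ->
  (gauss k)^* = chi (- 1) ^+ k * gauss l.
Proof.
move=> k0 l0 nkl; rewrite /gauss rmorph_sum [LHS](reindex_inj oppr_inj) mulr_sumr.
apply: eq_bigr => x _ /=; rewrite rmorphM rmorphXn /= -psiN opprK mulrA.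
congr (_ * _); rewrite -[- x]mulN1r chiM rmorphM exprMn /=; congr (_ * _).
  rewrite conj_chi; have: chi (-1) * chi (-1) = 1 by rewrite -chiM mulrNN mulr1 chi1.
  by move=> h; congr (_ ^+ _); apply: (mulfI (chi_neq0 (x := -1) _)); rewrite ?oppr_eq0
    ?oner_eq0 // mulfV ?h // chi_neq0 // oppr_eq0 oner_eq0.
have [->|x0] := eqVneq x 0; first by rewrite chi0 rmorph0 !expr0n !gtn_eqF.
rewrite conj_chi; apply: (mulfI (expf_neq0 k (chi_neq0 x0))).
rewrite exprVn mulfV ?expf_neq0 ?chi_neq0 // -exprD.
by case/dvdnP: nkl => c ->; rewrite mulnC exprM chi_unity // expr1n.
Qed.

(** The substitution of x^p for x leaves [psi] unchanged and multiplies the exponent by [p]: Gauss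
    sums are constant on Frobenius orbits of exponents. *)
Lemma gauss_frobenius p k : (0 < k)%N -> injective (fun x : F => x ^+ p) ->
  (0 < p)%N -> (forall x, psi (x ^+ p) = psi x) -> gauss (p * k) = gauss k.
Proof.
move=> k0 inj p0 psip; rewrite [RHS]/gauss (reindex_inj inj) /=.
by apply: eq_bigr => x _; rewrite psip chiX // exprM.
Qed.

(** Expand the d-th power map in characters. The trivial character contributes -1, which cancels the
    term x = 0; hence the sum over [k] starts at 1. *)
Lemma sum_psi_expr d a : (d %| n)%N -> a != 0 ->
  \sum_x psi (a * x ^+ d) = \sum_(1 <= k < d) chi a ^- (n %/ d * k) * gauss (n %/ d * k).
Proof.
move=> dn a0; have d0 : (0 < d)%N := dvdn_gt0 n_gt0 dn.
have pd : d.-primitive_root (chi g ^+ (n %/ d)).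
  by rewrite chi_gen; apply: dvdn_prim_root.
rewrite (bigD1 0) //= expr0n gtn_eqF // mulr0 psi0.
rewrite (sum_expr_character g_prim (fun x => psi (a * x)) (chi := fun x => chi x ^+ (n %/ d))) //.
- rewrite [X in 1 + X](_ : _ = \sum_(0 <= k < d)
    \sum_(x | x != 0) psi (a * x) * (chi x ^+ (n %/ d)) ^+ k); last first.
    by rewrite big_mkord exchange_big; apply: eq_bigr => x _; rewrite mulr_sumr.
  rewrite [X in 1 + X]big_ltn // addrA [X in 1 + X](_ : _ = -1) ?subrr ?add0r.
    apply: eq_big_nat => k /andP[k0 kd].
    have kd0 : (n %/ d * k == 0)%N = false.
      by apply/negbTE; rewrite -lt0n muln_gt0 k0 divn_gt0 // dvdn_leq.
    rewrite -(gauss_shift (n %/ d * k) a0).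
    rewrite [RHS](bigD1 0) //=.
    rewrite chi0 expr0n kd0 mul0r add0r.
    apply: eq_bigr => x _.
    by rewrite mulrC exprM.
  have := sum_psi a; rewrite (negPf a0) (bigD1 0) //= mulr0 psi0 => /eqP.
  rewrite addrC addr_eq0 => /eqP <-; apply: eq_bigr => x _.
  by rewrite expr0 mulr1.
- exact: dvdn_trans dn n_dvd.
- by move=> i; rewrite chi_genX chi_gen exprAC.
Qed.

(** The identity 4x(1 - x) = 1 - (2x - 1)^2 turns the left side into a sum over squares, which the
    quadratic character then unfolds. *)
Lemma jacobi_duplication k : (2%:R : F) != 0 -> (2 %| n)%N -> ~~ (n %| k)%N ->
  chi 4%:R ^+ k * jacobi k k = jacobi k (n %/ 2).
Proof.
move=> two0 n2 nk; have k0 : (0 < k)%N by case: k nk; rewrite ?dvdn0.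
have inj : injective (fun x : F => 1 - x) by move=> x y /addrI/oppr_inj.
have h0 : (0 < n %/ 2)%N by rewrite divn_gt0 // dvdn_leq.
have -> : chi 4%:R ^+ k * jacobi k k = \sum_u chi (1 - u ^+ 2) ^+ k.
  have inj2 : injective (fun x : F => 2%:R * x - 1) by move=> x y /addIr/(mulfI two0).
  rewrite [RHS](reindex_inj inj2) mulr_sumr; apply: eq_bigr => x _ /=.
  by rewrite -!exprMn -!chiM; congr (chi _ ^+ _); ring.
rewrite (bigD1 0) //= expr0n subr0 chi1 expr1n.
rewrite (sum_expr_character g_prim (fun v => chi (1 - v) ^+ k) (chi := fun x => chi x ^+ (n %/
  2))).
- rewrite jacobiC /jacobi [in RHS](bigD1 0) //= chi0 expr0n gtn_eqF // mul0r add0r.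
  under eq_bigr do rewrite !big_ord_recl big_ord0 addr0 mulrDr expr0 mulr1 expr1.
  rewrite big_split addrA /= [X in X + _](_ : _ = 0) ?add0r.
    by apply: eq_bigr => v _; rewrite mulrC.
  (* The term u = 0 supplies the missing v = 0 of the trivial-character part, which becomes a full
     sum of chi^k over F and vanishes. *)
  rewrite -[RHS](sum_chiX nk) [RHS](reindex_inj inj).
  by rewrite [RHS](bigD1 0) //= subr0 chi1 expr1n.
- exact: dvdn_trans n2 n_dvd.
- by rewrite chi_gen; apply: dvdn_prim_root.
- by move=> i; rewrite chi_genX chi_gen exprAC.
Qed.
End GaussSums.

(** * Counting by additive characters, and auxiliary arithmetic *)

(** Orthogonality of [psi] detects the equation; a = 0 gives q^n, and for every other [a] the sum
    over tuples factors into an n-th power. *)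
Lemma Nsol_sum_psi (F : finFieldType) (psi : F -> algC) (n m : nat) :
    psi 0 = 1 -> {morph psi : x y / x + y >-> x * y} ->
    (exists x, psi x != 1) ->
  #|F|%:R * (Nsol F n m)%:R =
    #|F|%:R ^+ n + \sum_(a | a != 0) (\sum_x psi (a * x ^+ (2 ^ m))) ^+ n.
Proof.
move=> psi0 psiD psi_nt.
have psi_sum I (r : seq I) (f : I -> F) : psi (\sum_(i <- r) f i) = \prod_(i <- r) psi (f i).
  exact: (big_morph psi psiD psi0).
transitivity (\sum_a (\sum_x psi (a * x ^+ (2 ^ m))) ^+ n); last first.
  rewrite (bigD1 0) //=; congr (_ ^+ _ + _).
  by under eq_bigr do rewrite mul0r psi0; rewrite sumr_const.
under eq_bigr => a _.
  rewrite -[n in _ ^+ n]card_ord -prodr_const bigA_distr_bigA /=.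
  under eq_bigr do rewrite -psi_sum -mulr_sumr.
  over.
rewrite exchange_big /= /Nsol.
under eq_bigr => x _.
  under eq_bigr do rewrite mulrC.
  rewrite (sum_psi psi0 psiD psi_nt); over.
rewrite -big_mkcond sumr_const mulr_natr; congr (_ *+ _).
by apply: eq_card => x; rewrite !inE.
Qed.

Lemma sum_powers (F : finFieldType) (k : nat) : (0 < k)%N ->
  \sum_(x : F) x ^+ k = if (#|F|.-1 %| k)%N then -1 else 0.
Proof.
move=> k0; have [g pg] := finField_prim_root F.
have q1 : (0 < #|F|)%N := ltnW (finNzRing_gt1 F).
(* Translation by 1 permutes F and adds |F| times 1 to the sum of all elements. *)
have q0 : #|F|%:R = 0 :> F.
  apply: (addrI (\sum_(x : F) x)); rewrite addr0 [RHS](reindex_inj (addIr 1)).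
  by rewrite big_split /= sumr_const.
case: ifPn => kq.
  rewrite (bigD1 0) //= expr0n gtn_eqF // add0r.
  rewrite (eq_bigr (fun=> 1)) => [|x /(gen_logP pg)[i ->]].
    by rewrite sumr_const cardC1; apply/eqP; rewrite -addr_eq0 natr1 prednK // q0.
  by case/dvdnP: kq => c ->; rewrite mulnC exprM (exprAC _ i) (prim_expr_order pg) !expr1n.
have: (g ^+ k - 1) * \sum_(x : F) x ^+ k = 0.
  rewrite mulrBl mul1r mulr_sumr; apply/eqP; rewrite subr_eq0; apply/eqP.
  rewrite [RHS](reindex_inj (mulfI (gen_neq0 pg))) /=.
  by apply: eq_bigr => x _; rewrite exprMn.
by move/eqP; rewrite mulf_eq0 subr_eq0 -(prim_order_dvd pg) (negPf kq) => /eqP.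
Qed.

(** The powers of [p] exhaust the residues 1 mod 4: p^(2^k) - 1 has 2-adic valuation exactly k + 2,
    so the exponent can be corrected one binary digit at a time. *)
Lemma two_power_orbit (p r u : nat) : (p %% 8 = 5 -> u %% 4 = 1 -> 1 < r ->
  exists j, p ^ j = u %[mod 2 ^ r])%N.
Proof.
move=> p5 u1; case: r => [|[|r]] // _.
have step k : exists w, (p ^ (2 ^ k) = 1 + 2 ^ k.+2 * w.*2.+1)%N.
  elim: k => [|k [w IHk]].
    exists (p %/ 8)%N; rewrite expn0 expn1 [LHS](divn_eq p 8) p5; lia.
  exists (w + 2 ^ k * (w.*2.+1) ^ 2)%N; rewrite expnSr expnM IHk.
  by rewrite !expnS expn0 -!muln2; move: (2 ^ k)%N => z; ring.
elim: r => [|r [j IHj]]; first by exists 0%N; rewrite expn0 u1.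
have [w Ew] := step r; set M := (2 ^ r.+2)%N in IHj Ew.
have mod2M a b c : (a = b %[mod 2] -> a * M + c = b * M + c %[mod 2 ^ r.+3])%N.
  move=> ab; rewrite [(2 ^ r.+3)%N]expnS -/M; apply/eqP.
  by rewrite eqn_modDr -!muln_modl ab.
have odd_pj : odd (p ^ j) by rewrite oddX; apply/orP; right; lia.
have [e|ne] := eqVneq ((p ^ j) %/ M %% 2)%N (u %/ M %% 2)%N.
  exists j; rewrite (divn_eq (p ^ j) M) (divn_eq u M) IHj; exact: mod2M.
(* Multiplication by p^(2^r) adds an odd multiple of [M] modulo 2M and so flips the one wrong
   bit. *)
exists (j + 2 ^ r)%N; rewrite expnD Ew.
have -> : (p ^ j * (1 + M * w.*2.+1) =
  (p ^ j %/ M + p ^ j * w.*2.+1) * M + p ^ j %% M)%N.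
  by rewrite {1}(divn_eq (p ^ j) M) mulnDl; nia.
rewrite IHj {2}(divn_eq u M); apply: mod2M.
have: odd (p ^ j * w.*2.+1) by rewrite oddM odd_pj /= odd_double.
move: ne; lia.
Qed.

(** All base-p digits of e = (p^s - 1)/4 equal (p - 1)/4, so adding [e] and [2 * e] produces no
    carry. The proof runs through Legendre's formula. *)
Lemma binomial_ndvd p s : prime p -> (p %% 4 = 1)%N ->
  ~~ (p %| 'C(3 * ((p ^ s).-1 %/ 4), (p ^ s).-1 %/ 4))%N.
Proof.
move=> p_pr p1; set e := ((p ^ s).-1 %/ 4)%N.
have p0 : (0 < p)%N := prime_gt0 p_pr.
have pX k : exists a, (p ^ k = 4 * a + 1)%N.
  elim: k => [|k [a IHk]]; first by exists 0%N.
  by exists (p * a + p %/ 4)%N; rewrite expnS IHk; lia.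
(* The remainder of [e] modulo p^k is b = (p^k - 1)/4, and c b < p^k for c < 4. *)
have e_lt k c : (c < 4 -> (c * e) %/ p ^ k = c * (e %/ p ^ k))%N.
  move=> c4; have [ks|sk] := leqP k s.
    have [a Ea] := pX (s - k)%N; have [b Eb] := pX k.
    have Es : (p ^ s = (4 * b + 1) * (4 * a + 1))%N.
      by rewrite -Ea -Eb -expnD subnKC.
    have Ee : (e = a * p ^ k + b)%N.
      rewrite /e Es Eb.
      rewrite (_ : ((4 * b + 1) * (4 * a + 1)).-1 = (a * (4 * b + 1) + b) * 4)%N ?mulnK //; nia.
    have d_lt : (c * b < p ^ k)%N by rewrite Eb; nia.
    rewrite Ee mulnDr mulnA !divnMDl ?expn_gt0 ?p0 //.
    by rewrite !divn_small ?addn0 // Eb; lia.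
  have lt : (p ^ s <= p ^ k)%N by rewrite leq_exp2l ?prime_gt1 // ltnW.
  have [a Ea] := pX s; have Ee : e = a by rewrite /e Ea addn1 /= mulKn.
  by rewrite !divn_small ?muln0 //; nia.
rewrite -[X in ~~ X](_ : (0 < logn p 'C(3 * e, e))%N = _); last first.
  rewrite logn_gt0 mem_primes p_pr bin_gt0 leq_pmull //.
have: logn p ('C(3 * e, e) * (e`! * (3 * e - e)`!)) = logn p (3 * e)`!.
  by rewrite bin_fact // leq_pmull.
rewrite (_ : 3 * e - e = 2 * e)%N; last by lia.
rewrite !lognM ?muln_gt0 ?fact_gt0 ?bin_gt0 ?leq_pmull // !logn_fact //.
(* The three Legendre sums are brought to a common range; the added terms vanish because p^k exceeds
   c e. *)
have ext c : (c < 4 -> \sum_(1 <= k < (c * e).+1) (c * e) %/ p ^ k =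
    \sum_(1 <= k < (3 * e).+1) c * (e %/ p ^ k))%N.
  move=> c4; rewrite [RHS](big_cat_nat (n := (c * e).+1)) //=; last by rewrite ltnS leq_mul2r
    -(ltnS c 3) c4 orbT.
  rewrite [X in (_ + X)%N]big1_seq ?addn0; first by apply: eq_bigr => k _; exact: e_lt.
  move=> k; rewrite mem_index_iota => /andP[_ /andP[ck _]].
  rewrite -e_lt // divn_small // (leq_trans _ (ltnW (ltn_expl k (prime_gt1 p_pr)))) //.
rewrite -[X in (\sum_(1 <= k < X.+1) X %/ _)%N](mul1n e) !ext // -!big_distrr /=.
lia.
Qed.

(** Exponents are grouped by 2-adic valuation m - r, that is, by the order 2^r of chi^k, and the odd
    part modulo 4 separates the two Frobenius orbits. The same grouping serves later for the indices
    of periods. *)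
Lemma sum_two_power (V : nmodType) (f : nat -> V) (m : nat) : (0 < m)%N ->
  \sum_(1 <= k < 2 ^ m) f k = f (2 ^ m.-1)%N +
    \sum_(2 <= r < m.+1) \sum_(i < 2 ^ (r - 2))
      (f (2 ^ (m - r) * (4 * i + 1))%N + f (2 ^ (m - r) * (4 * i + 3))%N).
Proof.
case: m => // m _; elim: m f => [|m IHm] f.
  by rewrite expn1 big_nat1 big_geq // addr0.
have -> : \sum_(1 <= k < 2 ^ m.+2) f k =
    \sum_(1 <= k < 2 ^ m.+1) f (2 * k)%N + \sum_(i < 2 ^ m.+1) f (2 * i + 1)%N.
  have n0 : (0 < 2 ^ m.+1)%N by rewrite expn_gt0.
  rewrite expnS; move: (2 ^ m.+1)%N n0 => [//|n] _; rewrite mulnS big_ltn // big_ord_recl.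
  rewrite !muln0 add0n addrCA; congr (_ + _).
  elim: n => [|n IHn]; first by rewrite !big_geq // big_ord0 addr0.
  rewrite (_ : 2 + 2 * n.+1 = (2 + 2 * n).+2)%N; last by lia.
  rewrite [in LHS]big_nat_recr // [in LHS]big_nat_recr //= IHn.
  rewrite [in RHS]big_nat_recr // big_ord_recr /= -!addrA; congr (_ + _).
  rewrite addrCA; congr (_ + (_ + _)); congr f; rewrite /bump /=; lia.
rewrite (IHm (fun k => f (2 * k)%N)) /= -expnS -addrA [in RHS]big_nat_recr //=.
congr (_ + (_ + _)).
  apply: eq_big_nat => r /andP[r2 rm].
  rewrite (_ : m.+2 - r = (m.+1 - r).+1)%N; last by lia.
  rewrite expnS.
  by apply: eq_bigr => i _; rewrite !mulnA.
rewrite subnn expnS (big_ord_mul (fun i => f (2 * i + 1)%N)) subSS subn1 /=.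
apply: eq_bigr => i _; rewrite !big_ord_recl big_ord0 addr0 /= /bump /=.
by congr (f _ + f _); lia.
Qed.

Lemma sum_powers_mul1B (F : finFieldType) (a : nat) : (0 < a)%N ->
  \sum_(x : F) (x * (1 - x)) ^+ a =
  \sum_(i < a.+1) ((-1) ^+ i *+ 'C(a, i)) * (if (#|F|.-1 %| a + i)%N then -1 else 0).
Proof.
move=> a0; under eq_bigr => x _.
  rewrite exprMn exprBn mulr_sumr.
  under eq_bigr do rewrite expr1n mulr1 mulrnAr mulrCA -exprD -mulrnAl.
  over.
rewrite exchange_big; apply: eq_bigr => i _ /=.
by rewrite -mulr_sumr sum_powers // addn_gt0 a0.
Qed.

(** * Gauss sums of 2-power order *)

Section PowerPeriods.
Variables (F : finFieldType) (p s m : nat) (g : F) (zeta : algC).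
Variables (psi chi : F -> algC).
Hypotheses (p_pr : prime p) (p5 : (p %% 8 = 5)%N) (cardF : #|F| = (p ^ s)%N).
Hypotheses (m_ge2 : (2 <= m)%N) (m_dvd : (2 ^ m %| (p ^ s).-1)%N).
Hypothesis m_max : ~~ (2 ^ m.+1 %| (p ^ s).-1)%N.
Hypothesis g_prim : #|F|.-1.-primitive_root g.
Hypothesis zeta_prim : (2 ^ m).-primitive_root zeta.
Hypothesis psi0 : psi 0 = 1.
Hypothesis psiD : {morph psi : x y / x + y >-> x * y}.
Hypothesis psi_nontrivial : exists x, psi x != 1.
Hypothesis psiN : forall x, psi (- x) = (psi x)^*.
Hypothesis psi_frobenius : forall x, psi (x ^+ p) = psi x.
Hypothesis psi_unity : forall x, psi x ^+ p = 1.
Hypothesis chi0 : chi 0 = 0.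
Hypothesis chi_gen : chi g = zeta.
Hypothesis chiM : {morph chi : x y / x * y}.

Local Notation q := (#|F|%:R : algC).
Local Notation G := (gauss psi chi).

Let charFp : p \in [pchar F] := card_finPcharP cardF p_pr.

Let m_dvdF : (2 ^ m %| #|F|.-1)%N. Proof. by rewrite cardF. Qed.

Let q_factor : exists2 f, odd f & #|F|.-1 = (2 ^ m * f)%N.
Proof.
case/dvdnP: m_dvdF => f E; exists f; last by rewrite E mulnC.
apply: contraR m_max => f2; rewrite -cardF E expnS dvdn_pmul2r ?expn_gt0 //.
by rewrite dvdn2.
Qed.

Let two_neq0 : (2%:R : F) != 0.
Proof. by rewrite -(dvdn_pcharf charFp); apply/negP => /dvdn_leq; lia. Qed.

Let one_neqN1 : (1 : F) != -1.
Proof. by rewrite -subr_eq0 opprK -mulr2n. Qed.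

Let chi_one : chi 1 = 1 := chi1 zeta_prim chi_gen chiM.

(** With q - 1 = 2^m f and [f] odd, the discrete logarithm of -1 cannot be divisible by 2^m. This is
    where the maximality of [m] enters. *)
Lemma chiN1 : chi (- 1) = -1.
Proof.
have sq : chi (-1) ^+ 2 = 1 by rewrite expr2 -chiM mulrNN mulr1 chi_one.
have /eqP := sq; rewrite sqrf_eq1 => /orP[/eqP c1|/eqP //].
have [i Ei] : exists i, -1 = g ^+ i by apply: (gen_logP g_prim); rewrite oppr_eq0 oner_eq0.
have i2 : (#|F|.-1 %| 2 * i)%N.
  by rewrite (prim_order_dvd g_prim) mulnC exprM -Ei sqrrN expr1n.
have i1 : ~~ (#|F|.-1 %| i)%N by rewrite (prim_order_dvd g_prim) -Ei eq_sym.
have im : (2 ^ m %| i)%N.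
  by rewrite (prim_order_dvd zeta_prim) -(chi_genX zeta_prim chi_gen chiM) -Ei c1.
case/negP: i1; have [f f_odd Ef] := q_factor; case/dvdnP: im => a Ea.
move: i2; rewrite Ef Ea [(a * 2 ^ m)%N]mulnC mulnCA.
by rewrite !dvdn_pmul2l ?expn_gt0 // Gauss_dvdr // coprimen2.
Qed.

(** For I^2 = -1 in F, p = 5 mod 8 gives (1 + I)^p = 1 + I^p = 1 + I. Then 1 = (1 + I)^(p-1) = (2
    I)^((p-1)/2), where I contributes -1. *)
Lemma two_nonresidue : (2%:R : F) ^+ (p.-1 %/ 2) = -1.
Proof.
have [f f_odd Ef] := q_factor.
have q4 : (4 %| #|F|.-1)%N by rewrite (dvdn_trans _ m_dvdF) // (dvdn_exp2l 2 m_ge2).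
have pI : 4.-primitive_root (g ^+ (#|F|.-1 %/ 4)) by apply: dvdn_prim_root.
set I := g ^+ _ in pI.
have I4 : I ^+ 4 = 1 := prim_expr_order pI.
have I2 : I ^+ 2 = -1.
  have /eqP : (I ^+ 2) ^+ 2 = 1 by rewrite -exprM.
  rewrite sqrf_eq1 => /orP[|/eqP //]; by rewrite -(prim_order_dvd pI).
have I1 : 1 + I != 0.
  by rewrite addrC addr_eq0; apply/eqP => IN; move: I2; rewrite IN sqrrN expr1n => /eqP;
    rewrite (negPf one_neqN1).
pose k := (p %/ 8)%N; have Ep : p = (8 * k + 5)%N by rewrite (divn_eq p 8) p5 mulnC.
have Ih : I ^+ (p.-1 %/ 2) = -1.
  have -> : (p.-1 %/ 2 = 4 * k + 2)%N by clear -Ep; lia.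
  by rewrite exprD exprM I4 expr1n mul1r.
have: (1 + I) ^+ p.-1 = 1.
  apply: (mulfI I1); rewrite -exprS prednK ?prime_gt0 // mulr1.
  rewrite exprDn_pchar ?pnatE // expr1n; congr (_ + _).
  have {1}-> : p = (4 * (2 * k + 1) + 1)%N by clear -Ep; lia.
  by rewrite exprD exprM I4 expr1n mul1r.
have {1}-> : (p.-1 = 2 * (p.-1 %/ 2))%N by clear -Ep; lia.
rewrite exprM (_ : (1 + I) ^+ 2 = 2%:R * I); last by rewrite sqrrD I2; ring.
rewrite exprMn Ih mulrN1 => /eqP; by rewrite eqr_oppLR => /eqP.
Qed.

(** With w = (p - 1)/4 odd, 4^w = 2^((p-1)/2) = -1, so chi(4)^w = -1. The order of chi(4)^2 divides
    both [w] and 2^m, so chi(4) is 1 or -1. *)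
Lemma chi4 : chi 4%:R = -1.
Proof.
pose k := (p %/ 8)%N; have Ep : p = (8 * k + 5)%N by rewrite (divn_eq p 8) p5 mulnC.
pose w := (2 * k + 1)%N.
have yw : chi 4%:R ^+ w = -1.
  have -> : 4%:R = 2%:R * 2%:R :> F by rewrite -natrM.
  rewrite chiM -expr2 -exprM -(chiX chiM); last by rewrite /w addn1.
  have -> : (2 * w = p.-1 %/ 2)%N by rewrite /w; clear -Ep; lia.
  by rewrite two_nonresidue chiN1.
have four_neq0 : (4%:R : F) != 0 by rewrite (natrM _ 2 2) mulf_neq0.
have ym := chi_unity g_prim zeta_prim chi_gen chiM four_neq0.
have y2w : (chi 4%:R ^+ 2) ^+ w = 1 by rewrite exprAC yw sqrrN expr1n.
have y2m : (chi 4%:R ^+ 2) ^+ (2 ^ m) = 1 by rewrite exprAC ym expr1n.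
have w0 : (0 < w)%N by rewrite /w addn1.
have [o po ow] := prim_order_exists w0 y2w.
have om : (o %| 2 ^ m)%N by rewrite (prim_order_dvd po) y2m.
have o1 : o = 1%N.
  apply/eqP; rewrite -dvdn1 -(eqP (_ : coprime w (2 ^ m))) ?dvdn_gcd ?ow //.
  by rewrite coprimeXr // coprimen2 oddD oddM.
have /eqP : chi 4%:R ^+ 2 = 1 by have := prim_expr_order po; rewrite o1 expr1.
rewrite sqrf_eq1 => /orP[/eqP y1|/eqP //].
by move: yw; rewrite y1 expr1n.
Qed.

Lemma gauss_mulX j k : (0 < k)%N -> G (p ^ j * k) = G k.
Proof.
move=> k0; elim: j => [|j IHj]; first by rewrite mul1n.
rewrite expnS -mulnA (gauss_frobenius chiM) //.
- by rewrite muln_gt0 k0 expn_gt0 prime_gt0.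
- by move=> x y; rewrite -!(pFrobenius_autE charFp); apply: fmorph_inj.
- exact: prime_gt0.
Qed.

Lemma gauss_orbit1 t i : G (2 ^ t * (4 * i + 1)) = G (2 ^ t).
Proof.
have m1 : (1 < m)%N by [].
have [|j Ej] := two_power_orbit (u := (4 * i + 1)%N) p5 _ m1; first by clear; lia.
have t0 : (0 < 2 ^ t)%N by rewrite expn_gt0.
rewrite -(gauss_mulX j t0); apply: (gauss_mod psi g_prim zeta_prim chi0 chi_gen chiM).
- by rewrite muln_gt0 t0 addn1.
- by rewrite muln_gt0 t0 expn_gt0 prime_gt0.
by rewrite mulnC -modnMml -Ej modnMml.
Qed.

Lemma gauss_orbit3 t i :
  G (2 ^ t * (4 * i + 3)) = (-1) ^+ (2 ^ t) * (G (2 ^ t))^*.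
Proof.
have t0 : (0 < 2 ^ t)%N by rewrite expn_gt0.
have m4 : (4 %| 2 ^ m)%N by rewrite (dvdn_exp2l 2 m_ge2).
have m0 : (0 < 2 ^ m)%N by rewrite expn_gt0.
(* Modulo 2^m this is -(4 i + 3), a class congruent to 1 mod 4, so conjugation leads back to
   [gauss_orbit1]. *)
pose u := ((2 ^ m).-1 * (4 * i + 3))%N.
have Eu : (u = 4 * (u %/ 4) + 1)%N.
  rewrite {1}(divn_eq u 4) mulnC; congr (_ + _)%N.
  rewrite /u; case/dvdnP: m4 m0 => a -> a0; rewrite -modnMm.
  have -> : (a * 4).-1 = (a.-1 * 4 + 3)%N by clear -a0; lia.
  by rewrite !modnMDl [(4 * i)%N]mulnC modnMDl.
rewrite -(gauss_orbit1 t (u %/ 4)) -Eu.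
have u0 : (0 < 2 ^ t * u)%N by rewrite muln_gt0 t0 Eu addn1.
rewrite (gauss_conj g_prim zeta_prim psiN chi0 chi_gen chiM (l := (2 ^ t * (4 * i + 3))%N)) //.
- have odd_u : odd u by rewrite Eu oddD oddM.
  by rewrite chiN1 mulrA -exprD -signr_odd oddD oddM odd_u andbT addbb mul1r.
- by rewrite muln_gt0 t0 addn3.
- rewrite -mulnDr -[X in (u + X)%N]mul1n -mulnDl addn1 prednK //.
  by rewrite dvdn_mull // dvdn_mulr.
Qed.

(* [gsum r], [per_even r] and [per_odd r] are [G_r], [c_r] and [d_r]; [quarter] plays
   the role of [i]. *)
Definition gsum r := G (2 ^ (m - r)).
(** This is the value at -1 of chi^(2^(m-r)): -1 for r = m and 1 for smaller [r]. *)
Definition gsign r : algC := (-1) ^+ (2 ^ (m - r)).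
Definition quarter : algC := zeta ^+ (2 ^ (m - 2)).
Definition per_even r := (gsum r + gsign r * (gsum r)^*) / 2%:R.
Definition per_odd r := (gsum r - gsign r * (gsum r)^*) / (2%:R * quarter).
Local Notation c := per_even.
Local Notation d := per_odd.

Let quarter4 : 4.-primitive_root quarter.
Proof.
rewrite /quarter (_ : 2 ^ (m - 2) = 2 ^ m %/ 4)%N; last first.
  have {2}-> : m = (m - 2 + 2)%N by rewrite subnK.
  by rewrite expnD mulnK.
by apply: dvdn_prim_root => //; rewrite (dvdn_exp2l 2 m_ge2).
Qed.

Lemma quarter_sqr : quarter ^+ 2 = -1.
Proof.
have /eqP : (quarter ^+ 2) ^+ 2 = 1 by rewrite -exprM (prim_expr_order quarter4).
by rewrite sqrf_eq1 => /orP[|/eqP //]; rewrite -(prim_order_dvd quarter4).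
Qed.

Let quarter_neq0 : quarter != 0.
Proof. by apply/eqP => I0; have /eqP := quarter_sqr; rewrite I0 expr0n eq_sym oppr_eq0
  oner_eq0. Qed.

Lemma gsign_lt r : (r < m)%N -> gsign r = 1.
Proof. by move=> rm; rewrite /gsign -signr_odd oddX subn_eq0 leqNgt rm. Qed.

Lemma gsign_sqr r : gsign r ^+ 2 = 1.
Proof. by rewrite sqrr_sign. Qed.

Lemma conj_gsign r : (gsign r)^* = gsign r.
Proof. by rewrite /gsign rmorphXn rmorphN1. Qed.

Let ndvd_pow k : (k < m)%N -> ~~ (2 ^ m %| 2 ^ k)%N.
Proof. by move=> km; rewrite dvdn_Pexp2l // -ltnNge. Qed.

Lemma gsum_norm r : (0 < r <= m)%N -> gsum r * (gsum r)^* = q.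
Proof.
move=> r0; apply: (gauss_norm g_prim zeta_prim psi0 psiD psi_nontrivial psiN chi0 chi_gen chiM).
by apply: ndvd_pow; clear -r0; lia.
Qed.

Let q_neq0 : q != 0.
Proof. by rewrite pnatr_eq0 -lt0n ltnW ?finNzRing_gt1. Qed.

Lemma gsum_neq0 r : (0 < r <= m)%N -> gsum r != 0.
Proof. by move/gsum_norm => E; apply: contraNneq q_neq0 => G0; rewrite -E G0 mul0r. Qed.

Lemma conj_gsum1 : (gsum 1)^* = gsum 1.
Proof.
have h0 : (0 < 2 ^ (m - 1))%N by rewrite expn_gt0.
rewrite /gsum (gauss_conj g_prim zeta_prim psiN chi0 chi_gen chiM h0 h0).
  by rewrite chiN1 -/(gsign 1) gsign_lt ?mul1r.
by rewrite addnn -mul2n -expnS subn1 prednK // ltnW.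
Qed.

Lemma per_even1 : c 1 = gsum 1.
Proof. by rewrite /per_even conj_gsum1 gsign_lt // mul1r -mulr2n -[_ *+ 2]mulr_natr mulfK
  ?pnatr_eq0. Qed.

Lemma per_even1_sqr : c 1 ^+ 2 = q.
Proof.
by rewrite per_even1 expr2 -{2}conj_gsum1 gsum_norm // (ltnW m_ge2).
Qed.

(* The Davenport-Hasse product formula for the quadratic character; the
   characters [chi ^ k] and [chi ^ (k + 2 ^ (m - 1))] are Frobenius conjugate. *)
Lemma gsum_sqr r : (2 < r <= m)%N -> gsum r ^+ 2 = gsign r * gsum 1 * gsum r.-1.
Proof.
case/andP=> r2 rm; set k := (2 ^ (m - r))%N; set h := (2 ^ (m - 1))%N.
have k0 : (0 < k)%N by rewrite expn_gt0.
have h0 : (0 < h)%N by rewrite expn_gt0.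
have Ekk : (k + k = 2 ^ (m - r.-1))%N.
  by rewrite addnn -mul2n -expnS; congr (_ ^ _)%N; clear -r2 rm; lia.
have Ekh : (k + h = 2 ^ (m - r) * (4 * 2 ^ (r - 3) + 1))%N.
  rewrite mulnDr muln1 addnC; congr (_ + _)%N.
  by rewrite -[4%N]/(2 ^ 2)%N -!expnD; congr (_ ^ _)%N; clear -r2 rm; lia.
have nkk : ~~ (2 ^ m %| k + k)%N by rewrite Ekk; apply: ndvd_pow; clear -r2 rm; lia.
have nkh : ~~ (2 ^ m %| k + h)%N.
  rewrite Ekh Gauss_dvdl ?ndvd_pow //; first by clear -r2 rm; lia.
  by rewrite coprimeXl // coprime2n oddD oddM.
(* As k + h is Frobenius conjugate to k, the factor [gsum r] will cancel and leave the Jacobi sum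
   equal to [gsum 1]. *)
have Ghk : gsum r * gsum 1 = jacobi chi k h * gsum r.
  rewrite /gsum (gaussM g_prim zeta_prim psiD chi0 chi_gen chiM k0 h0 nkh).
  by rewrite Ekh gauss_orbit1.
have Jkh : jacobi chi k h = gsum 1.
  by apply: (mulIf (@gsum_neq0 r _)); [clear -r2 rm; lia | rewrite -Ghk mulrC].
have := jacobi_duplication g_prim m_dvdF zeta_prim chi0 chi_gen chiM (k := k) two_neq0.
rewrite (dvdn_exp _ (dvdnn 2)) ?(ltnW m_ge2) // ndvd_pow; last by clear -r2 rm; lia.
move=> /(_ isT isT); rewrite chi4 -/(gsign r).
have -> : (2 ^ m %/ 2 = h)%N.
  rewrite /h; have {1}-> : m = (m - 1 + 1)%N by rewrite subnK // ltnW.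
  by rewrite expnD mulnK.
rewrite Jkh => <-; rewrite mulrA -expr2 gsign_sqr mul1r expr2 /gsum.
by rewrite (gaussM g_prim zeta_prim psiD chi0 chi_gen chiM k0 k0 nkk) Ekk.
Qed.

Definition jac4 := jacobi chi (2 ^ (m - 2)) (2 ^ (m - 2)).

(** For r = 2 the exponent k + h is 3k, in the other Frobenius orbit, so a genuine quartic Jacobi
    sum remains. *)
Lemma gsum2_sqr : gsum 2 ^+ 2 = jac4 * gsum 1.
Proof.
have k0 : (0 < 2 ^ (m - 2))%N by rewrite expn_gt0.
have Ekk : (2 ^ (m - 2) + 2 ^ (m - 2) = 2 ^ (m - 1))%N.
  by rewrite addnn -mul2n -expnS; congr (_ ^ _)%N; clear -m_ge2; lia.
have nkk : ~~ (2 ^ m %| 2 ^ (m - 2) + 2 ^ (m - 2))%N by rewrite Ekk; apply: ndvd_pow; clear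
  -m_ge2; lia.
by rewrite expr2 /gsum (gaussM g_prim zeta_prim psiD chi0 chi_gen chiM k0 k0 nkk) Ekk.
Qed.

Let per_sumsqr r : (0 < r <= m)%N -> c r ^+ 2 + d r ^+ 2 = gsign r * q.
Proof.
move=> rm; rewrite -(gsum_norm rm) /per_even /per_odd !exprMn !exprVn exprMn quarter_sqr.
have := gsign_sqr r; set e := gsign r; set x := gsum r; set y := x^* => _.
by field; rewrite ?pnatr_eq0.
Qed.

Let per_diffsqr r : c r ^+ 2 - d r ^+ 2 = (gsum r ^+ 2 + (gsum r ^+ 2)^*) / 2%:R.
Proof.
rewrite /per_even /per_odd !exprMn !exprVn exprMn quarter_sqr rmorphXn /=.
have := gsign_sqr r; set e := gsign r; set x := gsum r; set y := x^* => e2.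
transitivity ((x ^+ 2 + e ^+ 2 * y ^+ 2) / 2%:R); last by rewrite e2 mul1r.
by field; rewrite ?pnatr_eq0.
Qed.

Let half_eqs (x y u v : algC) : x + y = u -> x - y = v -> 2%:R * x = u + v /\ 2%:R * y = u - v.
Proof. by move=> <- <-; split; ring. Qed.

(** The norm of G_r gives c_r^2 + d_r^2, and the real part of G_r^2 gives c_r^2 - d_r^2, where
    [gsum_sqr] brings in c_(r-1). *)
Lemma per_rec r : (2 < r <= m)%N ->
  2%:R * c r ^+ 2 = gsign r * (q + c 1 * c r.-1) /\
  2%:R * d r ^+ 2 = gsign r * (q - c 1 * c r.-1).
Proof.
move=> r2; have rm : (0 < r <= m)%N by clear -r2; lia.
rewrite mulrDr mulrBr; apply: half_eqs; first exact: per_sumsqr.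
rewrite per_diffsqr gsum_sqr // !rmorphM /= conj_gsign conj_gsum1 per_even1.
rewrite /per_even [gsign r.-1]gsign_lt ?mul1r; last by clear -r2; lia.
by rewrite -mulrDr; ring.
Qed.

Lemma per2_rec :
  2%:R * c 2 ^+ 2 = gsign 2 * q + c 1 * ((jac4 + jac4^*) / 2%:R) /\
  2%:R * d 2 ^+ 2 = gsign 2 * q - c 1 * ((jac4 + jac4^*) / 2%:R).
Proof.
apply: half_eqs; first by apply: per_sumsqr; rewrite m_ge2.
rewrite per_diffsqr gsum2_sqr // !rmorphM /= conj_gsum1 per_even1.
by rewrite -mulrDl mulrAC mulrC.
Qed.

Lemma jac4_norm : jac4 * jac4^* = q.
Proof.
have := gsum2_sqr => E; have N2 := @gsum_norm 2 m_ge2; have N1 := @gsum_norm 1 (ltnW m_ge2).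
have: (gsum 2 ^+ 2) * (gsum 2 ^+ 2)^* = jac4 * jac4^* * q.
  by rewrite E rmorphM mulrACA N1.
rewrite rmorphXn -exprMn N2 expr2 => /(mulIf q_neq0) //.
Qed.

(** * Periods as combinations of Gauss sums *)

Definition period j := \sum_x psi (g ^+ j * x ^+ (2 ^ m)).
Local Notation y := (zeta^-1).
Local Notation I := quarter.

Let y_prim : (2 ^ m).-primitive_root y.
Proof.
have := conj_chi g_prim zeta_prim chi0 chi_gen chiM g; rewrite chi_gen => <-.
by rewrite fmorph_primitive_root.
Qed.

Lemma period_gauss j : period j = \sum_(1 <= k < 2 ^ m) y ^+ (j * k) * G k.
Proof.
have m0 : (0 < 2 ^ m)%N by rewrite expn_gt0.
have gj0 : g ^+ j != 0 by rewrite expf_neq0 ?(gen_neq0 g_prim).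
rewrite /period (sum_psi_expr g_prim m_dvdF zeta_prim psi0 psiD psi_nontrivial chi0 chi_gen
  chiM (dvdnn _) gj0).
apply: eq_bigr => k _; rewrite divnn m0 mul1n (chi_genX zeta_prim chi_gen chiM).
by rewrite -exprVn -exprVn -exprM.
Qed.

Lemma period_mod j : period (j %% 2 ^ m) = period j.
Proof.
rewrite !period_gauss; apply: eq_bigr => k _.
by rewrite !exprM (prim_expr_mod y_prim).
Qed.

(** The contribution to [period j] of the characters of exact order 2^r. The factor 2^(r-2) or 0 is
    the orthogonality sum over one Frobenius orbit of exponents. *)
Definition pterm r j : algC :=
  if r == 1%N then y ^+ (j * 2 ^ (m - 1)) * c 1
  else (if (2 ^ (r - 2) %| j)%N then (2 ^ (r - 2))%:R else 0) *
    (y ^+ (j * 2 ^ (m - r)) * gsum r + y ^+ (3 * (j * 2 ^ (m - r))) * (gsign r * (gsum r)^*)).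

Lemma period_pterm j : period j = \sum_(1 <= r < m.+1) pterm r j.
Proof.
have m0 : (0 < m)%N by apply: ltnW.
rewrite period_gauss sum_two_power // [RHS]big_ltn //; congr (_ + _).
  by rewrite /pterm /= per_even1 /gsum subn1.
apply: eq_big_nat => r /andP[r2 rm].
rewrite /pterm gtn_eqF //.
have yr : (2 ^ (r - 2)).-primitive_root (y ^+ (2 ^ (m - r + 2))).
  have -> : (2 ^ (m - r + 2) = 2 ^ m %/ 2 ^ (r - 2))%N.
    have {2}-> : m = (m - r + 2 + (r - 2))%N by clear -r2 rm; lia.
    by rewrite [in RHS]expnD mulnK // expn_gt0.
  by apply: dvdn_prim_root => //; apply: dvdn_exp2l; clear -r2 rm; lia.
rewrite -(sum_prim_root_expr j yr) mulr_suml; apply: eq_bigr => i _.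
rewrite gauss_orbit1 gauss_orbit3 -/(gsum r) -/(gsign r) mulrDr !mulrA.
rewrite -!exprM -!exprD; congr (y ^+ _ * _ + y ^+ _ * _ * _).
  by rewrite expnD; clear; nia.
by rewrite expnD; clear; nia.
Qed.

Lemma pterm_quarter r u : (2 <= r <= m)%N ->
  pterm r (2 ^ (r - 2) * u) =
  (2 ^ (r - 2))%:R * (I ^- u * gsum r + I ^- (3 * u) * (gsign r * (gsum r)^*)).
Proof.
case/andP=> r2 rm; rewrite /pterm gtn_eqF // dvdn_mulr //.
have -> : (2 ^ (r - 2) * u * 2 ^ (m - r) = 2 ^ (m - 2) * u)%N.
  by rewrite mulnAC -expnD; congr (2 ^ _ * _)%N; clear -r2 rm; lia.
have E k : y ^+ (2 ^ (m - 2) * k) = I ^- k by rewrite exprM !exprVn.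
by rewrite [(3 * _)%N]mulnCA !E.
Qed.

Let I2 : I^-1 ^+ 2 = -1. Proof. by rewrite exprVn quarter_sqr invrN1. Qed.

Let scale2 r (x : algC) : (2 <= r)%N -> (2 ^ (r - 2))%:R * x = (2 ^ r.-1)%:R * (x / 2%:R).
Proof.
move=> r2; have -> : (r.-1 = (r - 2).+1)%N by clear -r2; lia.
by rewrite expnSr natrM -mulrA [2%:R * _]mulrC mulfVK ?pnatr_eq0.
Qed.

(** Characters of order 2^r are trivial at g^j, so the two conjugate orbits add up to a multiple of
    c_r. *)
Lemma pterm_low r j : (0 < r <= m)%N -> (2 ^ r %| j)%N -> pterm r j = (2 ^ r.-1)%:R * c r.
Proof.
case/andP=> r0 rm rj; have [r1|r1] := eqVneq r 1%N.
  rewrite r1 /pterm /= mul1r; move: rj; rewrite r1 expn1 => /dvdnP[a ->].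
  have -> : (a * 2 * 2 ^ (m - 1) = 2 ^ m * a)%N.
    by rewrite -mulnA -expnS subn1 prednK ?(ltnW m_ge2) // mulnC.
  by rewrite exprM (prim_expr_order y_prim) expr1n mul1r.
have r2 : (2 <= r)%N by clear -r0 r1; lia.
case/dvdnP: rj => a ->; have -> : (a * 2 ^ r = 2 ^ (r - 2) * (2 * (2 * a)))%N.
  have {1}-> : r = (r - 2 + 2)%N by rewrite subnK.
  by rewrite expnD; clear; nia.
rewrite pterm_quarter ?r2 // scale2 // /per_even.
have E k : I ^- (2 * (2 * k)) = 1 by rewrite -exprVn exprM I2 exprM sqrrN expr1n expr1n.
by rewrite E (_ : (3 * (2 * (2 * a)) = 2 * (2 * (3 * a)))%N) ?E ?mul1r //; clear; lia.
Qed.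

(** At valuation exactly r - 1, characters of order 2^r take the value -1 at g^j. *)
Lemma pterm_mid r u : (0 < r <= m)%N ->
  pterm r (2 ^ r.-1 * (2 * u + 1)) = - (2 ^ r.-1)%:R * c r.
Proof.
case/andP=> r0 rm; have [->|r1] := eqVneq r 1%N.
  rewrite /pterm /= mulnC exprM (_ : y ^+ (2 ^ (m - 1)) = -1); last first.
    rewrite (_ : 2 ^ (m - 1) = 2 ^ (m - 2) * 2)%N ?exprM ?exprVn -/quarter ?quarter_sqr
      ?invrN1 //.
    by rewrite -expnSr; congr (_ ^ _)%N; clear -m_ge2; lia.
  by rewrite mul1n exprD exprM sqrrN !expr1n mul1r mulN1r.
have r2 : (2 <= r)%N by clear -r0 r1; lia.
have -> : (2 ^ r.-1 * (2 * u + 1) = 2 ^ (r - 2) * (2 * (2 * u + 1)))%N.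
  have -> : (r.-1 = (r - 2).+1)%N by clear -r2; lia.
  by rewrite expnSr mulnA.
rewrite pterm_quarter ?r2 // scale2 // /per_even mulNr -mulrN.
have E k : I ^- (2 * (2 * k + 1)) = -1.
  by rewrite -exprVn exprM I2 exprD exprM sqrrN !expr1n mul1r.
rewrite E (_ : (3 * (2 * (2 * u + 1)) = 2 * (2 * (3 * u + 1) + 1))%N) ?E; last by clear; lia.
by rewrite !mulN1r -opprD mulNr.
Qed.

Let IV1 k : I ^- (4 * k + 1) = I^-1.
Proof. by rewrite -exprVn exprD exprM -[4%N]/(2 * 2)%N exprM I2 sqrrN !expr1n mul1r. Qed.

Let IV3 k : I ^- (4 * k + 3) = - I^-1.
Proof.
rewrite -exprVn exprD exprM -[4%N]/(2 * 2)%N exprM I2 sqrrN !expr1n mul1r.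
by rewrite exprS I2 mulrN1.
Qed.

(** At valuation r - 2 the two conjugate orbits carry opposite fourth roots of unity, which isolates
    d_r. *)
Lemma pterm_odd1 r u : (2 <= r <= m)%N ->
  pterm r (2 ^ (r - 2) * (4 * u + 1)) = (2 ^ r.-1)%:R * d r.
Proof.
move=> rm; rewrite pterm_quarter // scale2; last by case/andP: rm.
rewrite (_ : (3 * (4 * u + 1) = 4 * (3 * u) + 3)%N); last by clear; lia.
by rewrite IV1 IV3 /per_odd invfM; ring.
Qed.

Lemma pterm_odd3 r u : (2 <= r <= m)%N ->
  pterm r (2 ^ (r - 2) * (4 * u + 3)) = - (2 ^ r.-1)%:R * d r.
Proof.
move=> rm; rewrite pterm_quarter // scale2; last by case/andP: rm.
rewrite (_ : (3 * (4 * u + 3) = 4 * (3 * u + 2) + 1)%N); last by clear; lia.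
by rewrite IV1 IV3 /per_odd invfM; ring.
Qed.

Lemma pterm_high r t u : (t + 2 < r)%N -> odd u -> pterm r (2 ^ t * u) = 0.
Proof.
move=> tr u_odd; rewrite /pterm gtn_eqF; last by clear -tr; lia.
rewrite Gauss_dvdl; last by rewrite coprimeXl // coprime2n.
by rewrite dvdn_Pexp2l // leqNgt (_ : (t < r - 2)%N) ?mul0r //; clear -tr; lia.
Qed.

Definition ksum t := \sum_(1 <= r < t.+1) (2 ^ r.-1)%:R * c r.

Let low_sum t j : (t <= m)%N -> (2 ^ t %| j)%N ->
  \sum_(1 <= r < t.+1) pterm r j = ksum t.
Proof.
move=> tm tj;  apply: eq_big_nat => r /andP[r0 rt]; apply: pterm_low.
  by clear -tm r0 rt; lia.
by apply: dvdn_trans tj; apply: dvdn_exp2l.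
Qed.

Let split_sum t u : (t + 2 <= m)%N -> odd u ->
  period (2 ^ t * u) = ksum t + pterm t.+1 (2 ^ t * u) + pterm t.+2 (2 ^ t * u).
Proof.
move=> tm u_odd; rewrite period_pterm (big_cat_nat (n := t.+3)) //=; last by clear -tm; lia.
rewrite [X in _ + X]big1_seq ?addr0.
  by rewrite big_nat_recr // big_nat_recr //= low_sum ?dvdn_mulr //; clear -tm; lia.
move=> r; rewrite mem_index_iota => /andP[_ /andP[tr _]].
by apply: pterm_high => //; clear -tr; lia.
Qed.

Lemma period1 t u : (t + 2 <= m)%N ->
  period (2 ^ t * (4 * u + 1)) =
  ksum t - (2 ^ t)%:R * c t.+1 + (2 ^ t.+1)%:R * d t.+2.
Proof.
move=> tm; rewrite split_sum //; last by rewrite oddD oddM.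
have -> : pterm t.+1 (2 ^ t * (4 * u + 1)) = - (2 ^ t)%:R * c t.+1.
  rewrite -(@pterm_mid t.+1 (2 * u)); last by clear -tm; lia.
  by congr (pterm _ (_ * _)%N); clear; lia.
have := @pterm_odd1 t.+2 u; rewrite /= subn2 /= => ->; last by clear -tm; lia.
by rewrite mulNr.
Qed.

Lemma period3 t u : (t + 2 <= m)%N ->
  period (2 ^ t * (4 * u + 3)) =
  ksum t - (2 ^ t)%:R * c t.+1 - (2 ^ t.+1)%:R * d t.+2.
Proof.
move=> tm; rewrite split_sum //; last by rewrite oddD oddM.
have -> : pterm t.+1 (2 ^ t * (4 * u + 3)) = - (2 ^ t)%:R * c t.+1.
  rewrite -(@pterm_mid t.+1 (2 * u + 1)); last by clear -tm; lia.
  by congr (pterm _ (_ * _)%N); clear; lia.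
have := @pterm_odd3 t.+2 u; rewrite /= subn2 /= => ->; last by clear -tm; lia.
by rewrite !mulNr.
Qed.

Lemma period0 : period 0 = ksum m.-1 + (2 ^ m.-1)%:R * c m.
Proof.
rewrite period_pterm low_sum // /ksum big_nat_recr //=; last exact: ltnW.
by rewrite prednK ?(ltnW m_ge2).
Qed.

Lemma period_half : period (2 ^ m.-1) = ksum m.-1 - (2 ^ m.-1)%:R * c m.
Proof.
rewrite period_pterm big_nat_recr //=; last exact: ltnW.
have := low_sum (leq_pred m) (dvdnn (2 ^ m.-1)); rewrite prednK ?(ltnW m_ge2) // => ->.
have := @pterm_mid m 0; rewrite muln0 add0n muln1 => ->; first by rewrite mulNr.
by rewrite (ltnW m_ge2) /=.
Qed.

(** The term x = 0 gives 1, the map x^(2^m) is 2^m-to-one on units, and the values of [psi] are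
    algebraic integers. *)
Lemma period_congruence j : exists2 z, z \in Aint & period j = 1 + (2 ^ m)%:R * z.
Proof.
rewrite /period (bigD1 0) //= expr0n gtn_eqF ?expn_gt0 // mulr0 psi0.
rewrite (sum_gen_expr g_prim (fun x => psi (g ^+ j * x)) m_dvdF).
exists (\sum_(i < #|F|.-1 %/ 2 ^ m) psi (g ^+ j * g ^+ (2 ^ m * i))); last by rewrite mulr_natl.
apply: rpred_sum => i _.
apply: (Aint_unity_root (prime_gt0 p_pr)); by apply/unity_rootP.
Qed.

(** As [period] depends on j modulo 2^m only, each residue class accounts for (q - 1)/2^m of the
    nonzero [a]. *)
Lemma Nsol_periods n :
  q * (Nsol F n m)%:R = q ^+ n + (q - 1) / (2 ^ m)%:R * \sum_(j < 2 ^ m) period j ^+ n.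
Proof.
rewrite (Nsol_sum_psi n m psi0 psiD psi_nontrivial); congr (_ + _).
rewrite (sum_gen g_prim); have [f _ Ef] := q_factor.
rewrite Ef (big_ord_mul (fun i => period i ^+ n)).
have -> : q - 1 = (2 ^ m * f)%:R.
  by rewrite -Ef -[in LHS](prednK (ltnW (finNzRing_gt1 F))) -natr1 addrK.
rewrite natrM [_ * f%:R]mulrC mulfK ?pnatr_eq0 -?lt0n ?expn_gt0 // mulr_natl.
rewrite -[f in RHS]card_ord -sumr_const; apply: eq_bigr => a _.
by apply: eq_bigr => b _; rewrite -period_mod mulnC modnMDl period_mod.
Qed.

Lemma sum_periods n : \sum_(j < 2 ^ m) period j ^+ n =
  (ksum m.-1 + (2 ^ m.-1)%:R * c m) ^+ n + (ksum m.-1 - (2 ^ m.-1)%:R * c m) ^+ n +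
  \sum_(0 <= t < m.-1) (2 ^ (m - 2 - t))%:R *
    ((ksum t - (2 ^ t)%:R * c t.+1 + (2 ^ t.+1)%:R * d t.+2) ^+ n +
     (ksum t - (2 ^ t)%:R * c t.+1 - (2 ^ t.+1)%:R * d t.+2) ^+ n).
Proof.
have m0 : (0 < m)%N := ltnW m_ge2.
rewrite -(big_mkord xpredT (fun j => period j ^+ n)) big_ltn ?expn_gt0 // period0 -addrA.
congr (_ + _); rewrite (sum_two_power (fun j => period j ^+ n)) // period_half; congr (_ + _).
(* The grouping is indexed by r = m - t; reversal makes the valuation [t] the index. *)
rewrite big_nat_rev (big_addn 0 m.+1 2 xpredT) /=.
have -> : (m.+1 - 2 = m.-1)%N by clear -m0; lia.
apply: eq_big_nat => t /andP[_ tm].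
have -> : (2 + m.+1 - (t + 2).+1 = m - t)%N by clear -tm; lia.
have -> : (m - t - 2 = m - 2 - t)%N by clear -tm; lia.
have -> : (m - (m - t) = t)%N by clear -tm; lia.
have t2 : (t + 2 <= m)%N by clear -tm; lia.
under eq_bigr do rewrite period1 // period3 //.
by rewrite sumr_const card_ord [RHS]mulr_natl.
Qed.

(** * The quartic Jacobi sum modulo [p] *)

Let e := (#|F|.-1 %/ 4)%N.
Let q4 : #|F|.-1 = (4 * e)%N.
Proof.
rewrite /e mulnC divnK // (dvdn_trans _ m_dvdF) //.
exact: (dvdn_exp2l 2 m_ge2).
Qed.
Let e_gt0 : (0 < e)%N.
Proof.
have q1 : (0 < #|F|.-1)%N := prim_order_gt0 g_prim.
by move: q1; rewrite q4 muln_gt0.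
Qed.

(** On units, x^e is the fourth root of unity in F matching the quartic character and x^(3e) is its
    inverse; their sum is the reduction of twice the real part. *)
Let quartic_value x : exists ab : int * int,
  chi x ^+ (2 ^ (m - 2)) = ab.1%:~R + I * ab.2%:~R /\
  (2 * ab.1)%:~R = x ^+ e + x ^+ (3 * e) :> F.
Proof.
have k0 : (0 < 2 ^ (m - 2))%N by rewrite expn_gt0.
have [->|/(gen_logP g_prim)[i ->]] := eqVneq x 0.
  exists (0, 0); rewrite chi0 !expr0n !gtn_eqF ?muln_gt0 ?e_gt0 //=.
  by rewrite mulr0 !addr0 mulr0.
have pz : 4.-primitive_root (g ^+ e) by apply: dvdn_prim_root => //; rewrite q4 dvdn_mulr.
have z2 : (g ^+ e) ^+ 2 = -1.
  have /eqP : ((g ^+ e) ^+ 2) ^+ 2 = 1 by rewrite -exprM (prim_expr_order pz).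
  by rewrite sqrf_eq1 => /orP[|/eqP //]; rewrite -(prim_order_dvd pz).
have z4 : (g ^+ e) ^+ 4 = 1 by rewrite (prim_expr_order pz).
have I4 : I ^+ 4 = 1 by rewrite (prim_expr_order quarter4).
rewrite (chi_genX zeta_prim chi_gen chiM) (exprAC _ i) -/quarter mulnC exprM !(exprAC _ i).
move: (g ^+ e) z2 z4 {pz} => z z2 z4.
have E (R : nzRingType) (w : R) : w ^+ 4 = 1 -> w ^+ i = w ^+ (i %% 4).
  by move=> w4; rewrite {1}(divn_eq i 4) exprD mulnC exprM w4 expr1n mul1r.
have z34 : (z ^+ 3) ^+ 4 = 1 by rewrite exprAC z4 expr1n.
rewrite !E //; have z3 : z ^+ 3 = - z by rewrite exprS z2 mulrN1.
have: (i %% 4 < 4)%N by rewrite ltn_mod.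
rewrite z3; move: (i %% 4)%N => [|[|[|[|//]]]] _.
- by exists (1, 0); rewrite /= mulr0 addr0 expr0 mulr1.
- by exists (0, 1); rewrite /= mulr1 add0r !expr1 mulr0 subrr.
- by exists (-1, 0); rewrite /= mulr0 addr0 quarter_sqr sqrrN z2 -opprD.
- exists (0, -1); rewrite /= [I ^+ 3]exprS quarter_sqr add0r; split; first by [].
  by rewrite mulr0 [z ^+ 3]z3 [(- z) ^+ 3]exprS sqrrN z2 mulrN1 opprK addNr.
Qed.

(** In F, [2 * a] becomes the sum of (x(1 - x))^e + (x(1 - x))^(3e), which equals a binomial
    coefficient up to sign; [binomial_ndvd] shows that it is nonzero. *)
Lemma jac4_int : exists a b : int,
  [/\ (jac4 + jac4^*) / 2%:R = a%:~R, a ^+ 2 + b ^+ 2 = (p ^ s)%N%:Z & ~~ (p%:Z %| a)%Z].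
Proof.
have [v vP] := fin_all_exists quartic_value.
pose a : int := \sum_(x : F) (v (x * (1 - x))).1.
pose b : int := \sum_(x : F) (v (x * (1 - x))).2.
have Jab : jac4 = a%:~R + I * b%:~R.
  rewrite /a /b !rmorph_sum mulr_sumr -big_split; apply: eq_bigr => x _ /=.
  by rewrite -exprMn -chiM (vP _).1.
have conjI : I^* = - I.
  have := conj_chi g_prim zeta_prim chi0 chi_gen chiM g; rewrite chi_gen => zc.
  rewrite /quarter rmorphXn /= zc exprVn -/quarter; apply: (mulfI quarter_neq0).
  by rewrite mulfV // mulrN -expr2 quarter_sqr opprK.
have conjJ : jac4^* = a%:~R - I * b%:~R.
  by rewrite Jab rmorphD rmorphM /= conjI !rmorph_int mulNr.
exists a, b; split.
- by rewrite conjJ Jab addrACA subrr addr0 -mulr2n -[_ *+ 2]mulr_natr mulfK ?pnatr_eq0.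
- apply: (intr_inj (R := algC)); rewrite -[RHS]/((p ^ s)%N%:R) -cardF -jac4_norm conjJ Jab.
  rewrite rmorphD !rmorphXn /=.
  transitivity (a%:~R ^+ 2 - I ^+ 2 * b%:~R ^+ 2 : algC); last by ring.
  by rewrite quarter_sqr mulN1r opprK.
apply/negP => /dvdzP[w aw].
have a0 : (2 * a)%:~R = 0 :> F.
  have p0 : (p%:Z)%:~R = 0 :> F by exact: (pcharf0 charFp).
  by rewrite aw !rmorphM /= p0 !mulr0.
have: (2 * a)%:~R = - ((-1) ^+ e *+ 'C(3 * e, e)) :> F.
  rewrite /a mulr_sumr rmorph_sum /=.
  under eq_bigr do rewrite (vP _).2.
  rewrite big_split /= !sum_powers_mul1B ?muln_gt0 ?e_gt0 //.
  (* The e-th power only has exponents from e to 2e, none a multiple of q - 1 = 4e. *)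
  rewrite big1 ?add0r => [|i _]; last first.
    rewrite q4 gtnNdvd ?mulr0 ?addn_gt0 ?e_gt0 //.
    by have := ltn_ord i; have := e_gt0; clear; lia.
  (* Among the exponents 3e + i with i at most 3e, only 4e is a multiple of q - 1. *)
  have e3 : (e < (3 * e).+1)%N by clear; lia.
  rewrite (bigD1 (Ordinal e3)) //= big1 ?addr0 => [|i ine].
    by rewrite q4 (_ : 3 * e + e = 4 * e)%N ?dvdnn ?mulrN1 //; clear; lia.
  case: ifPn => [|_]; rewrite ?mulr0 // q4 => /dvdnP[w' Ew].
  case/eqP: ine; apply: val_inj; move: Ew e_gt0; have /= := ltn_ord i; clear.
  by case: w' => [|[|w']]; nia.
rewrite a0 => /eqP; rewrite eq_sym oppr_eq0 -mulr_natr mulf_eq0 signr_eq0 /=.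
rewrite -(dvdn_pcharf charFp) /e cardF; apply/negP; apply: binomial_ndvd => //.
by move: p5; clear; lia.
Qed.

End PowerPeriods.

(** The characters are forgotten here: recursions, norm equation, congruences and counting formula
    suffice to evaluate the periods. [E 1 t] and [E (-1) t] are the periods with index of valuation
    [t]. *)
Lemma period_system (F : finFieldType) (p s m : nat) :
    prime p -> (p %% 8 = 5)%N -> #|F| = (p ^ s)%N ->
    (2 <= m)%N -> (2 ^ m %| (p ^ s).-1)%N -> ~~ (2 ^ m.+1 %| (p ^ s).-1)%N ->
  exists (c d : nat -> algC) (a b : int),
    let q : algC := (p ^ s)%N%:R in
    let sg r : algC := (-1) ^+ (2 ^ (m - r)) in
    let K t := \sum_(1 <= r < t.+1) (2 ^ r.-1)%N%:R * c r in
    let E (e : algC) t := K t - (2 ^ t)%N%:R * c t.+1 + e * ((2 ^ t.+1)%N%:R * d t.+2) in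
    [/\ [/\ c 1%N ^+ 2 = q,
            2%:R * c 2%N ^+ 2 = sg 2%N * q + c 1%N * a%:~R,
            2%:R * d 2%N ^+ 2 = sg 2%N * q - c 1%N * a%:~R &
            forall r, (2 < r <= m)%N ->
              2%:R * c r ^+ 2 = sg r * (q + c 1%N * c r.-1) /\
              2%:R * d r ^+ 2 = sg r * (q - c 1%N * c r.-1)],
        a ^+ 2 + b ^+ 2 = (p ^ s)%N%:Z /\ ~~ (p%:Z %| a)%Z,
        forall e t, e ^+ 2 = 1 -> (t + 2 <= m)%N ->
          exists2 z, z \in Aint & E e t = 1 + (2 ^ m)%N%:R * z,
        forall e, e ^+ 2 = 1 -> exists2 z, z \in Aint &
          K m.-1 + e * ((2 ^ m.-1)%N%:R * c m) = 1 + (2 ^ m)%N%:R * z &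
        forall n, q * (Nsol F n m)%:R = q ^+ n + (q - 1) / (2 ^ m)%N%:R *
         ((K m.-1 + (2 ^ m.-1)%N%:R * c m) ^+ n + (K m.-1 - (2 ^ m.-1)%N%:R * c m) ^+ n +
          \sum_(0 <= t < m.-1) (2 ^ (m - 2 - t))%N%:R * (E 1 t ^+ n + E (-1) t ^+ n))].
Proof.
move=> p_pr p5 cardF m2 m_dvd m_max.
have [psi [psiD psi_nt psi_fr psi_un]] := frobenius_additive_character p_pr cardF.
have p0 := prime_gt0 p_pr.
have psi_n0 x : psi x != 0.
  by apply/eqP => x0; have /eqP := psi_un x; rewrite x0 expr0n gtn_eqF // eq_sym oner_eq0.
have psi0 : psi 0 = 1.
  by apply: (mulfI (psi_n0 0)); rewrite -psiD addr0 mulr1.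
have psiN x : psi (- x) = (psi x)^*.
  apply: (mulfI (psi_n0 x)); rewrite -psiD subrr psi0 -normCK.
  have: `|psi x| ^+ p == 1 by rewrite -normrX psi_un normr1.
  by rewrite pexpr_eq1 // => /eqP ->; rewrite expr1n.
have [g g_prim] := finField_prim_root F.
have [zeta zeta_prim] := @C_prim_root_exists (2 ^ m) (eq_ind_r is_true isT (expn_gt0 2 m)).
have m_dvdF : (2 ^ m %| #|F|.-1)%N by rewrite cardF.
have [chi [chi0 chi_gen chiM]] := log_character g_prim m_dvdF zeta_prim.
have [a [b [Jab ab pa]]] := jac4_int p_pr p5 cardF m2 m_dvd g_prim zeta_prim psi0 psiD psi_nt
  psiN chi0 chi_gen chiM.
exists (per_even m psi chi), (per_odd m zeta psi chi), a, b => q sg K E.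
have qE : q = #|F|%:R by rewrite cardF.
have E1 t : (t + 2 <= m)%N -> E 1 t = period m g psi (2 ^ t * (4 * 0 + 1)).
  by move=> tm; rewrite (period1 p_pr p5 cardF m2 m_dvd m_max g_prim zeta_prim psi0 psiD
    psi_nt psiN psi_fr chi0 chi_gen chiM) // /E mul1r.
have EN1 t : (t + 2 <= m)%N -> E (-1) t = period m g psi (2 ^ t * (4 * 0 + 3)).
  by move=> tm; rewrite (period3 p_pr p5 cardF m2 m_dvd m_max g_prim zeta_prim psi0 psiD
    psi_nt psiN psi_fr chi0 chi_gen chiM) // /E mulN1r.
have cong j := period_congruence p_pr cardF m_dvd g_prim psi0 psi_un j.
split=> //.
- have [e1 e2] := per2_rec p_pr p5 cardF m2 m_dvd m_max g_prim zeta_prim psi0 psiD psi_nt psiN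
  chi0 chi_gen chiM.
  rewrite Jab -qE in e1 e2; split=> //; rewrite qE; first by eapply per_even1_sqr; eassumption.
  by move=> r rm; eapply per_rec; eassumption.
- by move=> e t /eqP; rewrite sqrf_eq1 => /orP[] /eqP -> tm; rewrite ?E1 ?EN1.
- have e0 : period m g psi 0 = K m.-1 + (2 ^ m.-1)%:R * per_even m psi chi m.
    by eapply period0; eassumption.
  have eh : period m g psi (2 ^ m.-1) = K m.-1 - (2 ^ m.-1)%:R * per_even m psi chi m.
    by eapply period_half; eassumption.
  by move=> e /eqP; rewrite sqrf_eq1 => /orP[] /eqP ->; rewrite ?mul1r ?mulN1r -?e0 -?eh.
- move=> n; rewrite qE (Nsol_periods cardF m_dvd m_max g_prim zeta_prim psi0 psiD psi_nt chi0
  chi_gen chiM).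
  rewrite (sum_periods p_pr p5 cardF m2 m_dvd m_max g_prim zeta_prim psi0 psiD psi_nt psiN
    psi_fr chi0 chi_gen chiM).
  congr (_ + _ * (_ + _)); apply: eq_bigr => t _.
  by rewrite /E mul1r mulN1r.
Qed.

(** * Sums of two squares and algebraic integers *)

(** The quotient is a rational algebraic integer, hence an integer. *)
Lemma Aint_dvdz (d : nat) (x : int) (z : algC) : (0 < d)%N ->
  z \in Aint -> x%:~R = d%:R * z -> (d%:Z %| x)%Z.
Proof.
move=> d0 zA E; have zE : z = x%:~R / d%:R.
  by rewrite E mulrC mulKf // pnatr_eq0 -lt0n.
have : z \is a Num.int.
  by apply: Cint_rat_Aint zA; rewrite zE rpred_div ?rpred_int ?rpred_nat.
case/intrP => k zk; apply/dvdzP; exists k; apply: (intr_inj (R := algC)).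
by rewrite E zk mulrC rmorphM.
Qed.

(** If 8 divides p^s - 1 then [s] is even, and p^s - 1 = (x - 1)(x + 1) with x = p^(s/2) = 1 mod 4.
    Since x + 1 is twice an odd number, halving [s] costs exactly one factor 2. *)
Lemma two_adic_exponent (p s m : nat) : (p %% 8 = 5 -> 0 < s ->
  2 ^ m %| (p ^ s).-1 -> 2 ^ (m - 2) %| s)%N.
Proof.
move=> p5; elim: m s => [|m IHm] s s0; first by rewrite dvd1n.
have [m1|m2] := leqP m 1; first by rewrite (_ : m.+1 - 2 = 0)%N ?dvd1n //; lia.
have pX k : (p ^ k %% 8 = if odd k then 5 else 1)%N.
  elim: k => // k IHk; rewrite expnS -modnMm p5 IHk /=; by case: (odd k).
have pX0 k : (0 < p ^ k)%N by have := pX k; case: (p ^ k)%N; case: odd.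
have [s_odd|s_even] := boolP (odd s).
  move/(dvdn_trans (dvdn_exp2l 2 (_ : 3 <= m.+1)%N)) => /(_ m2).
  move: (pX s) (pX0 s); rewrite s_odd; clear; lia.
have Es : s = (2 * s./2)%N by rewrite mul2n even_halfK.
have h0 : (0 < s./2)%N by clear -Es s0; lia.
move: (pX s./2) (pX0 s./2) (IHm _ h0).
have -> : (p ^ s = p ^ s./2 * p ^ s./2)%N by rewrite {1}Es mul2n -addnn expnD.
set x := (p ^ s./2)%N => x8 x0 IH; rewrite (_ : (x * x).-1 = x.-1 * x.+1)%N; last by clear
  -x0; nia.
have -> : (x.+1 = 2 * (x.+1 %/ 2))%N by case: odd x8; clear; lia.
rewrite mulnCA expnS dvdn_pmul2l // Gauss_dvdl; last first.
  by rewrite coprimeXl // coprime2n; case: odd x8; clear; lia.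
move/IH => /dvdnP[k Ek]; rewrite Es Ek.
have -> : (m.+1 - 2 = (m - 2).+1)%N by clear -m2; lia.
by rewrite expnS mulnCA dvdn_mull.
Qed.

Section SumOfTwoSquares.
Variables (p k : nat).
Hypotheses (p_pr : prime p) (p_odd : odd p) (k_gt0 : (0 < k)%N).
Variables (C D C' D' : int).
Hypotheses (CD : C ^+ 2 + D ^+ 2 = (p ^ k)%N%:Z) (CD' : C' ^+ 2 + D' ^+ 2 = (p ^ k)%N%:Z).
Hypotheses (pC : ~~ (p%:Z %| C)%Z) (pC' : ~~ (p%:Z %| C')%Z).
Hypotheses (C4 : (C == -1 %[mod 4])%Z) (C4' : (C' == -1 %[mod 4])%Z).

Let pk_odd : odd (p ^ k). Proof. by rewrite oddX p_odd orbT. Qed.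

Let euclid (x y : int) : (p%:Z %| x * y)%Z -> (p%:Z %| x)%Z || (p%:Z %| y)%Z.
Proof. by rewrite !dvdzE abszM Euclid_dvdM. Qed.

Let pD' : ~~ (p%:Z %| D')%Z.
Proof.
apply/negP => pD; have : (p%:Z %| C' * C')%Z.
  rewrite -expr2 (_ : C' ^+ 2 = (p ^ k)%N%:Z - D' ^+ 2); last by rewrite -CD' addrK.
  rewrite rpredB // ?expr2 ?dvdz_mull //.
  by rewrite dvdzE /= dvdn_exp.
by move/euclid; rewrite (negPf pC').
Qed.

Let coprime_pk (x : int) : ~~ (p%:Z %| x)%Z -> coprimez (p ^ k)%N%:Z x.
Proof. by rewrite dvdzE coprimezE /= => h; rewrite coprimeXl // prime_coprime. Qed.

(* If [p ^ k] divides [C D' - C' D], then [(C D' - C' D)^2 + (C C' + D D')^2 = p ^ (2 k)]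
   leaves only [C D' = C' D], since [C C' + D D'] is odd. *)
Let sqr_eq_aux (E : int) : C ^+ 2 + E ^+ 2 = (p ^ k)%N%:Z ->
  ((p ^ k)%N%:Z %| C * D' - C' * E)%Z -> C ^+ 2 = C' ^+ 2.
Proof.
move=> CE /dvdzP[z Ez]; set P := (p ^ k)%N%:Z in CE Ez *.
have P0 : 0 < P by rewrite /P ltz_nat expn_gt0 prime_gt0.
have Podd : (P %% 2)%Z = 1 by move: pk_odd; rewrite /P; clear; lia.
have norm : (z * P) ^+ 2 + (C * C' + E * D') ^+ 2 = P ^+ 2.
  by rewrite -Ez [RHS]expr2 -{1}CE /P -CD'; ring.
have Wodd : (C * C' + E * D') != 0.
  apply/eqP => W0.
  have [u Eu] : exists u, C = 2 * u + 1 by exists (C %/ 2)%Z; move: C4; clear; lia.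
  have [u' Eu'] : exists u, C' = 2 * u + 1 by exists (C' %/ 2)%Z; move: C4'; clear; lia.
  have [v [Ev|Ev]] : exists v, E = 2 * v \/ E = 2 * v + 1.
  - by exists (E %/ 2)%Z; clear; lia.
  - have : 2 * (2 * u * u' + u + u' + v * D') + 1 = 0.
      by rewrite -W0 Eu Eu' Ev; ring.
    by move: (_ + v * D'); clear; lia.
  have : P = 2 * (2 * u ^+ 2 + 2 * u + 2 * v ^+ 2 + 2 * v + 1) by rewrite -CE Eu Ev; ring.
  by move: Podd => + PE; rewrite PE; move: (_ + 1); clear; lia.
have z0 : z = 0.
  have W1 : 0 < (C * C' + E * D') ^+ 2 by rewrite exprn_even_gt0.
  apply/eqP; apply: contraT => z0; have z1 : 1 <= z ^+ 2 by rewrite -gtz0_ge1 exprn_even_gt0.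
  have : P ^+ 2 <= (z * P) ^+ 2 by rewrite exprMn ler_peMl ?sqr_ge0.
  by rewrite -norm gerDl leNgt W1.
move/eqP: Ez; rewrite z0 mul0r subr_eq0 => /eqP e.
have : P * C ^+ 2 = P * C' ^+ 2.
  transitivity ((C * D') ^+ 2 + C ^+ 2 * C' ^+ 2); first by rewrite /P -CD'; ring.
  by rewrite e -CE; ring.
by move/(mulfI (lt0r_neq0 P0)).
Qed.

(** The product of C D' - C' D and C D' + C' D is a multiple of p^k. Their sum 2 C D' is prime to
    [p], so p^k divides one factor; the second case is the first with -D. The class modulo 4 settles
    the sign. *)
Lemma sum_two_squares_unique : C = C'.
Proof.
have : C ^+ 2 = C' ^+ 2.
  have prod : ((p ^ k)%N%:Z %| (C * D' - C' * D) * (C * D' + C' * D))%Z.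
    apply/dvdzP; exists (C ^+ 2 - C' ^+ 2); rewrite [RHS]mulrBl -[in X in _ = X - _]CD' -CD; ring.
  have [pX|pX] := boolP (p%:Z %| C * D' - C' * D)%Z.
    have pY : ~~ (p%:Z %| C * D' + C' * D)%Z.
      apply/negP => pY; have : (p%:Z %| 2 * (C * D'))%Z.
        have -> : 2 * (C * D') = (C * D' - C' * D) + (C * D' + C' * D) by ring.
        exact: rpredD.
      move/euclid/orP=> [|/euclid]; last by rewrite (negPf pC) (negPf pD').
      rewrite dvdzE /= => /dvdn_leq; move: p_odd (prime_gt1 p_pr); clear; lia.
    apply: (sqr_eq_aux CD); move: prod; rewrite Gauss_dvdzl //; exact: coprime_pk.
  apply: (sqr_eq_aux (E := - D)); first by rewrite sqrrN.
  by move: prod; rewrite mulrN opprK Gauss_dvdzr //; exact: coprime_pk.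
move/eqP; rewrite eqf_sqr => /orP[/eqP //|/eqP CN].
by move: C4 C4'; rewrite CN; clear; lia.
Qed.
End SumOfTwoSquares.

(** * Evaluation of the periods *)

(** Every fractional power becomes a natural power of one root, so identities between them reduce to
    natural exponents. *)
Lemma qpow_root (q : algC) (m r k : nat) : 0 <= q -> (r <= m)%N ->
  qpow q k (2 ^ r) = (2 ^ m).-root q ^+ (k * 2 ^ (m - r)).
Proof.
move=> q0 rm; have m0 : (0 < 2 ^ m)%N by rewrite expn_gt0.
have r0 : (0 < 2 ^ r)%N by rewrite expn_gt0.
rewrite /qpow -{1}(rootCK m0 q) -exprM.
have -> : (2 ^ m * k = k * 2 ^ (m - r) * 2 ^ r)%N.
  by rewrite -mulnA -expnD subnK // mulnC.
by rewrite exprM exprCK // exprn_ge0 // rootC_ge0.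
Qed.

Lemma qpow_prime_power (p s j : nat) : (2 ^ j %| s)%N ->
  qpow (p ^ s)%N%:R 1 (2 ^ j) = (p ^ (s %/ 2 ^ j))%N%:R.
Proof.
by move=> js; rewrite /qpow expr1 -{1}(divnK js) expnM natrX exprCK ?expn_gt0 // ?ler0n.
Qed.

(** Each pair of conjugate periods depends on the square only, so the signs of d_r, D_r and c_m are
    immaterial. *)
Lemma exprDB_sqr_eq (u x y : algC) n : x ^+ 2 = y ^+ 2 ->
  (u + x) ^+ n + (u - x) ^+ n = (u + y) ^+ n + (u - y) ^+ n.
Proof.
move/eqP; rewrite eqf_sqr => /orP[] /eqP -> //.
by rewrite opprK addrC.
Qed.

Section PeriodValues.
Variables (p s m : nat) (C D : nat -> int) (c d : nat -> algC) (a b : int).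
Hypotheses (p_pr : prime p) (p5 : (p %% 8 = 5)%N) (s_gt0 : (0 < s)%N).
Hypotheses (m_ge3 : (3 <= m)%N) (s_dvd : (2 ^ (m - 2) %| s)%N).
Hypothesis CD : forall r, (1 <= r <= m.-1)%N ->
     [/\ C r ^+ 2 + D r ^+ 2 = ((p ^ (s %/ 2 ^ r.-1))%N)%:Z,
         (C r == -1 %[mod 4])%Z & ~~ (p%:Z %| C r)%Z].
Local Notation q := ((p ^ s)%N%:R : algC).
Hypothesis c1_sqr : c 1%N ^+ 2 = q.
Hypothesis c2_sqr : 2%:R * c 2%N ^+ 2 = q + c 1%N * a%:~R.
Hypothesis d2_sqr : 2%:R * d 2%N ^+ 2 = q - c 1%N * a%:~R.
Hypothesis c_rec : forall r, (2 < r < m)%N -> 2%:R * c r ^+ 2 = q + c 1%N * c r.-1.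
Hypothesis d_rec : forall r, (2 < r < m)%N -> 2%:R * d r ^+ 2 = q - c 1%N * c r.-1.
Hypotheses (ab : a ^+ 2 + b ^+ 2 = (p ^ s)%N%:Z) (pa : ~~ (p%:Z %| a)%Z).
Hypothesis c_cong : forall t, (t + 2 <= m)%N -> exists2 z, z \in Aint &
  \sum_(1 <= r < t.+1) (2 ^ r.-1)%N%:R * c r - (2 ^ t)%N%:R * c t.+1 = 1 + (2 ^ m.-1)%N%:R * z.

(* [rho r] is [q ^ ((2 ^ (r - 1) - 1) / 2 ^ r)] and [hroot] is [q ^ (1 / 2)]. *)
Definition qroot : algC := (2 ^ m).-root q.
Definition rho r := qroot ^+ ((2 ^ r.-1 - 1) * 2 ^ (m - r)).
Definition hroot := qroot ^+ (2 ^ m.-1).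

Let p_odd : odd p. Proof. by move: p5; clear; lia. Qed.
Let p0 : (0 < p)%N := prime_gt0 p_pr.
Let q_gt0 : 0 < q. Proof. by rewrite ltr0n expn_gt0 p0. Qed.
Let qrootX : qroot ^+ (2 ^ m) = q. Proof. by rewrite rootCK ?expn_gt0. Qed.
Let s_dvd_le j : (j <= m - 2)%N -> (2 ^ j %| s)%N.
Proof. by move=> jm; apply: dvdn_trans s_dvd; apply: dvdn_exp2l. Qed.

Let pX_mod4 k : (p ^ k %% 4 = 1)%N.
Proof. by elim: k => // k IHk; rewrite expnS -modnMm IHk; move: p5; clear; lia. Qed.

Lemma rho_qpow r : (r <= m)%N -> qpow q (2 ^ r.-1 - 1) (2 ^ r) = rho r.
Proof. by move=> rm; rewrite (qpow_root _ _ rm) ?ltW. Qed.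

Lemma rho_sqr r : (2 <= r <= m)%N -> rho r ^+ 2 = hroot * rho r.-1.
Proof.
case/andP=> r2 rm; rewrite /rho /hroot -exprM -exprD; congr (_ ^+ _).
have -> : (m.-1 = r.-2 + (m - r).+1)%N by clear -r2 rm; lia.
have -> : (m - r.-1 = (m - r).+1)%N by clear -r2 rm; lia.
have -> : (r.-1 = r.-2.+1)%N by clear -r2; lia.
rewrite expnD !expnS /=; have : (0 < 2 ^ r.-2)%N by rewrite expn_gt0.
move: (2 ^ r.-2)%N (2 ^ (m - r))%N; clear => x y x0; nia.
Qed.

Lemma rho_pi r : (1 <= r <= m)%N -> rho r ^+ 2 * qroot ^+ (2 ^ (m - r.-1)) = q.
Proof.
case/andP=> r2 rm; rewrite -qrootX /rho -exprM -exprD; congr (_ ^+ _).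
have {3}-> : (m = r.-1 + (m - r).+1)%N by clear -r2 rm; lia.
have -> : (m - r.-1 = (m - r).+1)%N by clear -r2 rm; lia.
rewrite expnD !expnS /=; have : (0 < 2 ^ r.-1)%N by rewrite expn_gt0.
move: (2 ^ r.-1)%N (2 ^ (m - r))%N; clear => x y x0; nia.
Qed.

Lemma pi_root r : (1 <= r <= m.-1)%N ->
  qroot ^+ (2 ^ (m - r.-1)) = (p ^ (s %/ 2 ^ r.-1))%N%:R.
Proof.
move=> rm; rewrite -qpow_prime_power; last by apply: s_dvd_le; clear -rm; lia.
rewrite (@qpow_root _ m); [by rewrite mul1n | exact: ltW | clear -rm; lia].
Qed.

Let hroot_nat : hroot = (p ^ (s %/ 2))%N%:R.
Proof.
have := @pi_root 2; rewrite subn1 expn1 => <- //; clear -m_ge3; lia.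
Qed.

Let hroot_sqr : hroot ^+ 2 = q.
Proof.
rewrite -qrootX -exprM -expnSr prednK //; clear -m_ge3; lia.
Qed.

(** The instances r - 1 and r of [c_cong] differ by 2^r (c_r - c_(r+1)), so c_(r+1) = c_r modulo
    2^(m-1-r); the instance 0 gives c_1 = -1 modulo 2^(m-1). *)
Lemma c_mod r : (1 <= r <= m.-1)%N ->
  exists2 z, z \in Aint & c r = -1 + (2 ^ (m - r))%N%:R * z.
Proof.
elim: r => // -[_ _|r IHr rm].
  have [|z zA] := @c_cong 0; first by clear -m_ge3; lia.
  rewrite big_geq // add0r mul1r subn1 => E; exists (- z); rewrite ?rpredN //.
  by rewrite mulrN -opprD -E opprK.
have [|z zA cE] := IHr; first by clear -rm; lia.
have [|z0 z0A E0] := @c_cong r; first by clear -rm; lia.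
have [|z1 z1A E1] := @c_cong r.+1; first by clear -rm; lia.
have Em : ((2 ^ m.-1)%:R = (2 ^ r.+1)%:R * (2 ^ (m - r.+2))%:R :> algC).
  by rewrite -natrM -expnD; congr ((2 ^ _)%:R); clear -rm; lia.
have Em' : ((2 ^ (m - r.+1))%:R = 2%:R * (2 ^ (m - r.+2))%:R :> algC).
  by rewrite -natrM -expnS; congr ((2 ^ _)%:R); clear -rm; lia.
have r0 : ((2 ^ r.+1)%:R : algC) != 0 by rewrite pnatr_eq0 -lt0n expn_gt0.
exists (2%:R * z + z0 - z1); first by rewrite rpredB ?rpredD ?rpredM ?rpred_nat.
apply: (mulfI r0); move: E1; rewrite big_nat_recr //= Em => E1.
have -> : (2 ^ r.+1)%:R * c r.+2 = \sum_(1 <= r0 < r.+1) (2 ^ r0.-1)%:R * c r0 + (2 ^ r)%:R *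
  c r.+1 - (1 + (2 ^ r.+1)%:R * (2 ^ (m - r.+2))%:R * z1).
  by rewrite -E1; ring.
have -> : \sum_(1 <= r0 < r.+1) (2 ^ r0.-1)%:R * c r0 = 1 + (2 ^ r.+1)%:R * (2 ^ (m -
  r.+2))%:R * z0 + (2 ^ r)%:R * c r.+1.
  by rewrite -Em -E0; ring.
by rewrite cE Em' expnS natrM; ring.
Qed.

(** The root q^(1/2) is a power of [p], hence 1 mod 4, whereas c_1 is -1 mod 4. *)
Lemma c1_value : c 1%N = - hroot.
Proof.
have /eqP : c 1%N ^+ 2 = hroot ^+ 2 by rewrite c1_sqr hroot_sqr.
rewrite eqf_sqr => /orP[/eqP c1h|/eqP //].
have [|z zA cE] := @c_mod 1; first by clear -m_ge3; lia.
have E4 : ((p ^ (s %/ 2))%N%:Z + 1)%:~R = 4%:R * ((2 ^ (m - 3))%N%:R * z) :> algC.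
  rewrite rmorphD /= -[(_%:Z)%:~R]/((p ^ (s %/ 2))%N%:R) -hroot_nat -c1h cE mulrA -natrM.
  rewrite (_ : 4 * 2 ^ (m - 3) = 2 ^ (m - 1))%N; first by ring.
  by rewrite -[4%N]/(2 ^ 2)%N -expnD; congr (_ ^ _)%N; clear -m_ge3; lia.
have := Aint_dvdz (_ : (0 < 4)%N) _ E4; rewrite rpredM ?rpred_nat // => /(_ isT isT).
by move: (pX_mod4 (s %/ 2)); clear; lia.
Qed.

(** With c_2 = -1 + 2w and h = q^(1/2), the equation 2 c_2^2 = h^2 - h a gives h^2 - h a = 2 modulo
    8, where h = 1 mod 4. *)
Lemma a_mod : (a == -1 %[mod 4])%Z.
Proof.
have [|z zA cE] := @c_mod 2; first by clear -m_ge3; lia.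
pose w := (2 ^ (m - 3))%N%:R * z.
have wA : w \in Aint by rewrite rpredM ?rpred_nat.
have cw : c 2%N = -1 + 2%:R * w.
  rewrite cE /w mulrA -natrM -expnS; congr (_ + (2 ^ _)%:R * _); clear -m_ge3; lia.
pose h := (p ^ (s %/ 2))%N; have hh : hroot = h%:R := hroot_nat.
have E8 : (h%:Z ^+ 2 - h%:Z * a - 2)%:~R = 8%:R * (w ^+ 2 - w) :> algC.
  rewrite !rmorphB rmorphXn rmorphM /= -[(h%:Z)%:~R]/(h%:R) -hh hroot_sqr.
  transitivity (2%:R * c 2%N ^+ 2 - 2%:R); last by rewrite cw; ring.
  by rewrite c2_sqr c1_value mulNr.
have := Aint_dvdz (_ : (0 < 8)%N) _ E8; rewrite rpredB ?rpredX // => /(_ isT isT).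
have [k Ek] : exists k, h%:Z = 4 * k + 1.
  by exists (h %/ 4)%N%:Z; have := pX_mod4 (s %/ 2); rewrite -/h; clear; lia.
rewrite (_ : h%:Z ^+ 2 - h%:Z * a - 2 = 4 * (4 * k ^+ 2 + 2 * k - k * a) - 1 - a); last by
  rewrite Ek; ring.
by move: (_ - k * a); clear; lia.
Qed.

Lemma a_value : a = C 1%N.
Proof.
have [|e1 e2 e3] := CD (r := 1); first by clear -m_ge3; lia.
rewrite /= divn1 in e1.
exact: (sum_two_squares_unique p_pr p_odd s_gt0 ab e1 pa e3 a_mod e2).
Qed.

(** The square of C_r + i D_r has norm p^(s/2^(r-2)) and real part C_r^2 - D_r^2. As D_r is even,
    the negative of that real part is -1 mod 4, and uniqueness identifies it with C_(r-1). *)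
Lemma C_rec r : (2 <= r <= m.-1)%N -> C r.-1 = D r ^+ 2 - C r ^+ 2.
Proof.
move=> rm; have [|e1 e2 e3] := CD (r := r); first by clear -rm; lia.
have [|e1' e2' e3'] := CD (r := r.-1); first by clear -rm; lia.
have sr : (2 ^ r.-1 %| s)%N by apply: s_dvd_le; clear -rm; lia.
have Es : (s %/ 2 ^ r.-2 = 2 * (s %/ 2 ^ r.-1))%N.
  rewrite -{1}(divnK sr) (_ : r.-1 = r.-2.+1)%N; last by clear -rm; lia.
  by rewrite expnS mulnA mulnK ?expn_gt0 // mulnC.
have s0 : (0 < s %/ 2 ^ r.-2)%N.
  by rewrite Es muln_gt0 /= divn_gt0 ?expn_gt0 //; apply: dvdn_leq.
have norm : (D r ^+ 2 - C r ^+ 2) ^+ 2 + (2 * C r * D r) ^+ 2 = (p ^ (s %/ 2 ^ r.-2))%N%:Z.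
  by rewrite Es mulnC expnM -mulnn PoszM -e1; ring.
have C2 : exists k, C r = 4 * k - 1 by exists ((C r + 1) %/ 4)%Z; move: e2; clear; lia.
have [k Ek] := C2.
have [v Ev] : exists v, D r = 2 * v.
  have [v [Ev|Ev]] : exists v, D r = 2 * v \/ D r = 2 * v + 1.
  - by exists (D r %/ 2)%Z; clear; lia.
  - by exists v.
  have: (p ^ (s %/ 2 ^ r.-1))%N%:Z = 2 * (8 * k ^+ 2 - 4 * k + 2 * v ^+ 2 + 2 * v + 1).
    by rewrite -e1 Ek Ev; ring.
  by move: (pX_mod4 (s %/ 2 ^ r.-1)); move: (_ + 1) => w; clear; lia.
apply: (sum_two_squares_unique p_pr p_odd s0 e1' norm e3') => //.
  apply/negP => pN; have: (p%:Z %| 2 * C r ^+ 2)%Z.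
    have -> : 2 * C r ^+ 2 = C r ^+ 2 + D r ^+ 2 - (D r ^+ 2 - C r ^+ 2) by ring.
    apply: rpredB => //; rewrite e1 dvdzE /= dvdn_exp // divn_gt0 ?expn_gt0 // dvdn_leq //.
  move: e3; rewrite !dvdzE abszM abszX Euclid_dvdM // Euclid_dvdX // andbT => /negPf ->.
  rewrite orbF => /dvdn_leq; move: p5; clear; lia.
rewrite Ek Ev (_ : _ - _ = 4 * (v ^+ 2 - 4 * k ^+ 2 + 2 * k) - 1); last by ring.
by move: (_ + 2 * k); clear; lia.
Qed.

(** Here q = rho_r^2 (C_r^2 + D_r^2), and [C_rec] turns q^(1/2) x into rho_r^2 (D_r^2 - C_r^2);
    subtracting or adding isolates one square. *)
Let core r (x y : algC) : (2 <= r <= m.-1)%N -> x = rho r.-1 * (C r.-1)%:~R ->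
  (2%:R * y ^+ 2 = q - hroot * x -> y ^+ 2 = (rho r * (C r)%:~R) ^+ 2) /\
  (2%:R * y ^+ 2 = q + hroot * x -> y ^+ 2 = (rho r * (D r)%:~R) ^+ 2).
Proof.
move=> rm ->; have two0 : (2%:R : algC) != 0 by rewrite pnatr_eq0.
have [|e1 _ _] := CD (r := r); first by clear -rm; lia.
have pi_r : qroot ^+ (2 ^ (m - r.-1)) = (C r)%:~R ^+ 2 + (D r)%:~R ^+ 2.
  rewrite pi_root -?rmorphXn -?rmorphD /= ?e1 //; clear -rm; lia.
have qr := @rho_pi r; rewrite mulrA -rho_sqr -?qr ?pi_r; try by clear -rm; lia.
rewrite C_rec // rmorphB !rmorphXn /=.
by split=> E; apply: (mulfI two0); rewrite E; ring.
Qed.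

Let rho_nat r : (1 <= r <= m - 2)%N -> exists k, rho r = (p ^ k)%N%:R.
Proof.
move=> rm; exists (s %/ 2 ^ r * (2 ^ r.-1 - 1))%N.
have rs : (2 ^ r %| s)%N by apply: s_dvd_le; clear -rm; lia.
rewrite -rho_qpow; last by clear -rm; lia.
rewrite /qpow -natrX -expnM -{1}(divnK rs) mulnAC [in LHS]expnM natrX exprCK ?expn_gt0 ?ler0n //.
Qed.

Lemma cd_values r : (2 <= r <= m.-1)%N ->
  [/\ c r ^+ 2 = (rho r * (C r)%:~R) ^+ 2, d r ^+ 2 = (rho r * (D r)%:~R) ^+ 2 &
      (r <= m - 2)%N -> c r = rho r * (C r)%:~R].
Proof.
(* For k at most m - 2, c_k = -1 holds modulo 4, C_k is -1 mod 4 and rho_k is a power of [p], so the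
   sign is +. For k = m - 1 the congruence is only modulo 2. *)
have sgn k : (2 <= k <= m - 2)%N -> c k ^+ 2 = (rho k * (C k)%:~R) ^+ 2 ->
    c k = rho k * (C k)%:~R.
  move=> km /eqP; rewrite eqf_sqr => /orP[/eqP //|/eqP ck].
  have [|j rj] := @rho_nat k; first by clear -km; lia.
  have [|z zA cE] := @c_mod k; first by clear -km; lia.
  have [|_ e2 _] := CD (r := k); first by clear -km; lia.
  have E4 : ((p ^ j)%N%:Z * C k - 1)%:~R = 4%:R * (- ((2 ^ (m - 2 - k))%N%:R * z)) :> algC.
    rewrite rmorphB rmorphM /= -[(_%:Z)%:~R]/((p ^ j)%N%:R) -rj -[_ * _]opprK -ck cE.
    have -> : (2 ^ (m - k))%:R = 4%:R * (2 ^ (m - 2 - k))%:R :> algC.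
      rewrite -natrM -[4%N]/(2 ^ 2)%N -expnD; congr ((2 ^ _)%:R); clear -km; lia.
    by ring.
  have := Aint_dvdz (_ : (0 < 4)%N) _ E4; rewrite rpredN rpredM ?rpred_nat // => /(_ isT isT).
  have [u Eu] : exists u, (p ^ j)%N%:Z = 4 * u + 1.
    by exists ((p ^ j) %/ 4)%N%:Z; move: (pX_mod4 j); clear; lia.
  have [v Ev] : exists v, C k = 4 * v - 1 by exists ((C k + 1) %/ 4)%Z; move: e2; clear; lia.
  rewrite Eu Ev (_ : _ - 1 = 4 * (4 * u * v - u + v) - 2); last by ring.
  by move: (_ + v); clear; lia.
elim: r => // -[//|[_ r2|r IHr rm]].
  (* The integer [a] takes the place of c_(r-1) in the recursion for r = 2, with rho_1 = 1. *)
  have rho1 : a%:~R = rho 1 * (C 1%N)%:~R by rewrite /rho mul0n mul1r a_value.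
  have [h1 _] := core (c 2%N) r2 rho1; have [_ h2] := core (d 2%N) r2 rho1.
  have ec : c 2%N ^+ 2 = (rho 2 * (C 2%N)%:~R) ^+ 2 by apply: h1; rewrite c2_sqr c1_value mulNr.
  split=> //; first by apply: h2; rewrite d2_sqr c1_value mulNr opprK.
  by move=> m2; apply: sgn.
have [|_ _ cE] := IHr; first by clear -rm; lia.
have {}cE : c r.+2 = rho r.+2 * (C r.+2)%:~R by apply: cE; clear -rm; lia.
have [h1 _] := core (c r.+3) rm cE; have [_ h2] := core (d r.+3) rm cE.
have r3 : (2 < r.+3 < m)%N by clear -rm; lia.
have ec : c r.+3 ^+ 2 = (rho r.+3 * (C r.+3)%:~R) ^+ 2.
  by apply: h1; rewrite c_rec // c1_value mulNr.
split=> //; first by apply: h2; rewrite d_rec // c1_value mulNr opprK.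
by move=> m2; apply: sgn.
Qed.

Hypothesis c_top : 2%:R * c m ^+ 2 = - (q + c 1%N * c m.-1).
Hypothesis d_top : 2%:R * d m ^+ 2 = - (q - c 1%N * c m.-1).

Let ksum_value t : (1 <= t <= m - 2)%N ->
  \sum_(1 <= r < t.+1) (2 ^ r.-1)%N%:R * c r = - qpow q 1 2 +
   \sum_(2 <= r < t.+1) (2 ^ r.-1)%N%:R * (C r)%:~R * qpow q (2 ^ r.-1 - 1) (2 ^ r).
Proof.
move=> tm; rewrite big_ltn //; last by clear -tm; lia.
rewrite mul1r c1_value; congr (- _ + _).
  rewrite -[2%N in RHS]/(2 ^ 1)%N (@qpow_root _ m) ?ltW // ?mul1n ?subn1 //; clear -m_ge3; lia.
apply: eq_big_nat => r rt; have [|_ _ ->] := @cd_values r; try by clear -tm rt; lia.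
by rewrite rho_qpow; [ring | clear -tm rt; lia].
Qed.

Let scale_top (x : algC) : (2 ^ m.-1)%N%:R * x = (2 ^ (m - 2))%N%:R * (2%:R * x).
Proof.
by rewrite mulrA -natrM -expnSr; congr ((2 ^ _)%:R * _); clear -m_ge3; lia.
Qed.

(** At r = m the sign of q is reversed, whence the factor ['i]. Since q = q^(1/2) rho_(m-1)
    q^(1/2^(m-1)), the factor rho_m^2 = q^(1/2) rho_(m-1) comes out. *)
Let top_sqr (e : algC) y : 2%:R * y ^+ 2 = - (q - e * hroot * (rho m.-1 * (C m.-1)%:~R)) ->
  ((2 ^ m.-1)%N%:R * y) ^+ 2 = ((2 ^ (m - 2))%N%:R * qpow q (2 ^ m.-1 - 1) (2 ^ m) * 'i *
     sqrtC (2%:R * (qpow q 1 (2 ^ m.-1) - e * (C m.-1)%:~R))) ^+ 2.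
Proof.
move=> E; have rE := @rho_sqr m; have qE := @rho_pi m.
rewrite scale_top !exprMn sqrtCK sqrCi rho_qpow // (@qpow_root _ m) ?ltW //; last exact: leq_pred.
rewrite mul1n rE; last by clear -m_ge3; lia.
have {}qE : q = hroot * rho m.-1 * qroot ^+ (2 ^ (m - m.-1)).
  by rewrite -rE -?qE //; clear -m_ge3; lia.
rewrite [2%:R ^+ 2]expr2 -[2%:R * 2%:R * _]mulrA E [in LHS]qE; ring.
Qed.

Lemma bracket_value n :
   let K t := \sum_(1 <= r < t.+1) (2 ^ r.-1)%N%:R * c r in
   let E (e : algC) t := K t - (2 ^ t)%N%:R * c t.+1 + e * ((2 ^ t.+1)%N%:R * d t.+2) in
   let P : algC := - qpow q 1 2 +
       \sum_(2 <= r < m.-1) (2 ^ r.-1)%N%:R * (C r)%:~R * qpow q (2 ^ r.-1 - 1) (2 ^ r) in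
   let A : algC := (2 ^ (m - 2))%N%:R * (C m.-1)%:~R * qpow q (2 ^ (m - 2) - 1) (2 ^ m.-1) in
   let B : algC := (2 ^ (m - 2))%N%:R * qpow q (2 ^ m.-1 - 1) (2 ^ m) * 'i in
   let Em : algC := sqrtC (2%:R * (qpow q 1 (2 ^ m.-1) - (C m.-1)%:~R)) in
   let Ep : algC := sqrtC (2%:R * (qpow q 1 (2 ^ m.-1) + (C m.-1)%:~R)) in
   let T (t : nat) : algC := - qpow q 1 2
       + \sum_(2 <= r < t.+1) (2 ^ r.-1)%N%:R * (C r)%:~R * qpow q (2 ^ r.-1 - 1) (2 ^ r)
       - (2 ^ t)%N%:R * (C t.+1)%:~R * qpow q (2 ^ t - 1) (2 ^ t.+1) in
   let U (t : nat) : algC :=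
       (2 ^ t.+1)%N%:R * (D t.+2)%:~R * qpow q (2 ^ t.+1 - 1) (2 ^ t.+2) in
   (K m.-1 + (2 ^ m.-1)%N%:R * c m) ^+ n + (K m.-1 - (2 ^ m.-1)%N%:R * c m) ^+ n +
     \sum_(0 <= t < m.-1) (2 ^ (m - 2 - t))%N%:R * (E 1 t ^+ n + E (-1) t ^+ n) =
     (2 ^ (m - 2))%N%:R *
         ((qpow q 1 2 + 2%:R * (D 2%N)%:~R * qpow q 1 4) ^+ n
          + (qpow q 1 2 - 2%:R * (D 2%N)%:~R * qpow q 1 4) ^+ n)
     + \sum_(1 <= t < m - 2) (2 ^ (m - t - 2))%N%:R *
         ((T t + U t) ^+ n + (T t - U t) ^+ n)
     + (P + A + B * Em) ^+ n
     + (P + A - B * Em) ^+ n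
     + (P - A + B * Ep) ^+ n
     + (P - A - B * Ep) ^+ n.
Proof.
move=> K E P A B Em Ep T U.
have Em1 : (m.-1 = (m - 2).+1)%N by clear -m_ge3; lia.
have KP : K (m - 2)%N = P by rewrite /K ksum_value /P -?Em1 //; clear -m_ge3; lia.
have KS : K m.-1 = P + (2 ^ (m - 2))%:R * c m.-1.
  by rewrite Em1 /K big_nat_recr //= -/(K (m - 2)%N) KP.
have Epair t : E 1 t ^+ n + E (-1) t ^+ n =
    (K t - (2 ^ t)%:R * c t.+1 + (2 ^ t.+1)%:R * d t.+2) ^+ n +
    (K t - (2 ^ t)%:R * c t.+1 - (2 ^ t.+1)%:R * d t.+2) ^+ n.
  by rewrite /E mul1r mulN1r.
have step0 : E 1 0%N ^+ n + E (-1) 0%N ^+ n =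
    (qpow q 1 2 + 2%:R * (D 2%N)%:~R * qpow q 1 4) ^+ n
    + (qpow q 1 2 - 2%:R * (D 2%N)%:~R * qpow q 1 4) ^+ n.
  rewrite Epair /K big_geq // add0r mul1r c1_value opprK.
  have -> : qpow q 1 2 = hroot.
    rewrite -[2%N]/(2 ^ 1)%N (@qpow_root _ m) ?ltW // ?mul1n ?subn1 //; clear -m_ge3; lia.
  apply: exprDB_sqr_eq; have [|_ dE _] := @cd_values 2; first by clear -m_ge3; lia.
  rewrite exprMn dE -(@rho_qpow 2); last by clear -m_ge3; lia.
  by rewrite -exprMn; congr (_ ^+ 2); ring.
have step t : (1 <= t < m - 2)%N -> E 1 t ^+ n + E (-1) t ^+ n = (T t + U t) ^+ n + (T t - U
  t) ^+ n.
  move=> tm; rewrite Epair.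
  have -> : K t - (2 ^ t)%:R * c t.+1 = T t.
    rewrite /K ksum_value; last by clear -tm; lia.
    have [|_ _ ->] := @cd_values t.+1; try by clear -tm; lia.
    rewrite -(@rho_qpow t.+1); last by clear -tm; lia.
    by rewrite /T /=; ring.
  apply: exprDB_sqr_eq; have [|_ dE _] := @cd_values t.+2; first by clear -tm; lia.
  rewrite exprMn dE -(@rho_qpow t.+2); last by clear -tm; lia.
  by rewrite /U -exprMn; congr (_ ^+ 2); rewrite /=; ring.
have top : (K m.-1 + (2 ^ m.-1)%N%:R * c m) ^+ n + (K m.-1 - (2 ^ m.-1)%N%:R * c m) ^+ n +
    (E 1 (m - 2)%N ^+ n + E (-1) (m - 2)%N ^+ n) =
    (P + A + B * Em) ^+ n + (P + A - B * Em) ^+ n +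
    ((P - A + B * Ep) ^+ n + (P - A - B * Ep) ^+ n).
  rewrite Epair KP KS -Em1 (_ : m.-1.+1 = m)%N; last by clear -m_ge3; lia.
  have AE : A = (2 ^ (m - 2))%:R * (rho m.-1 * (C m.-1)%:~R).
    by rewrite /A -(rho_qpow (leq_pred m)) (_ : m.-1.-1 = m - 2)%N; [ring | clear; lia].
  have [|cE _ _] := @cd_values m.-1; first by clear -m_ge3; lia.
  have Em' : (B * Em) ^+ 2 = (B * sqrtC (2%:R * (qpow q 1 (2 ^ m.-1) - 1 * (C m.-1)%:~R))) ^+ 2.
    by rewrite mul1r.
  have Ep' : (B * Ep) ^+ 2 = (B * sqrtC (2%:R * (qpow q 1 (2 ^ m.-1) - (-1) * (C m.-1)%:~R)))
    ^+ 2.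
    by rewrite mulN1r opprK.
  (* The other sign of c_(m-1) exchanges the roles of c_m and d_m and swaps the two pairs of
     terms. *)
  have/eqP := cE; rewrite eqf_sqr => /orP[] /eqP cE'.
    rewrite cE' -AE; congr (_ + _); apply: exprDB_sqr_eq.
      by rewrite Em'; apply: top_sqr; rewrite c_top c1_value cE'; ring.
    by rewrite Ep'; apply: top_sqr; rewrite d_top c1_value cE'; ring.
  rewrite cE' mulrN opprK -AE addrC; congr (_ + _); apply: exprDB_sqr_eq.
    by rewrite Em'; apply: top_sqr; rewrite d_top c1_value cE'; ring.
  by rewrite Ep'; apply: top_sqr; rewrite c_top c1_value cE'; ring.
have splitS (f : nat -> algC) :
    \sum_(0 <= t < m.-1) f t = f 0%N + \sum_(1 <= t < m - 2) f t + f (m - 2)%N.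
  by rewrite Em1 big_nat_recr //= big_ltn //; clear -m_ge3; lia.
rewrite splitS subnn mul1r subn0 step0.
have -> : \sum_(1 <= t < m - 2) (2 ^ (m - 2 - t))%:R * (E 1 t ^+ n + E (-1) t ^+ n) =
    \sum_(1 <= t < m - 2) (2 ^ (m - t - 2))%:R * ((T t + U t) ^+ n + (T t - U t) ^+ n).
  by apply: eq_big_nat => t tm; rewrite step // subnAC.
rewrite addrCA top [LHS]addrA [in LHS]addrA -!addrA; do ?congr (_ + _).
Qed.

End PeriodValues.

(** The case m = 2. As q = 5 mod 8, [s] is odd and c1 is irrational; its sign stays open, and
    changing it only permutes the four terms. *)
Lemma quartic_bracket (p s : nat) (C1 D1 a b : int) (c1 c2 d2 : algC) n :
    let q : algC := (p ^ s)%N%:R in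
    prime p -> (p %% 8 = 5)%N -> (0 < s)%N -> (p ^ s %% 8 = 5)%N ->
    C1 ^+ 2 + D1 ^+ 2 = (p ^ s)%N%:Z -> (C1 == -1 %[mod 4])%Z -> ~~ (p%:Z %| C1)%Z ->
    c1 ^+ 2 = q -> 2%:R * c2 ^+ 2 = - q + c1 * a%:~R -> 2%:R * d2 ^+ 2 = - q - c1 * a%:~R ->
    a ^+ 2 + b ^+ 2 = (p ^ s)%N%:Z -> ~~ (p%:Z %| a)%Z ->
    (forall e : algC, e ^+ 2 = 1 -> exists2 z, z \in Aint & c1 + e * (2%:R * c2) = 1 + 4%:R *
      z) ->
  (c1 + 2%:R * c2) ^+ n + (c1 - 2%:R * c2) ^+ n +
  ((- c1 + 2%:R * d2) ^+ n + (- c1 - 2%:R * d2) ^+ n) =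
     (- qpow q 1 2 + qpow q 1 4 * 'i * sqrtC (2%:R * (qpow q 1 2 + C1%:~R))) ^+ n
     + (- qpow q 1 2 - qpow q 1 4 * 'i * sqrtC (2%:R * (qpow q 1 2 + C1%:~R))) ^+ n
     + (qpow q 1 2 + qpow q 1 4 * 'i * sqrtC (2%:R * (qpow q 1 2 - C1%:~R))) ^+ n
     + (qpow q 1 2 - qpow q 1 4 * 'i * sqrtC (2%:R * (qpow q 1 2 - C1%:~R))) ^+ n.
Proof.
move=> q p_pr p5 s0 q5 CD C4 pC c1q c2E d2E ab pa cong.
have a4 : (a == -1 %[mod 4])%Z.
  have [z zA zE] := cong 1 (expr1n _ _).
  have [y yA yE] := cong (-1) (etrans (sqrrN _) (expr1n _ _)).
  rewrite mul1r in zE; rewrite mulN1r in yE.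
  have two0 : (2%:R : algC) != 0 by rewrite pnatr_eq0.
  have c2z : c2 = z - y.
    apply: (mulfI (_ : (4%:R : algC) != 0)); first by rewrite pnatr_eq0.
    transitivity ((c1 + 2%:R * c2) - (c1 - 2%:R * c2)); first by ring.
    by rewrite zE yE; ring.
  have c1z : c1 = 1 + 2%:R * (z + y).
    apply: (mulfI two0); transitivity ((c1 + 2%:R * c2) + (c1 - 2%:R * c2)); first by ring.
    by rewrite zE yE; ring.
  pose k := (p ^ s %/ 8)%N.
  have qk : q = 8%:R * k%:R + 5%:R.
    by rewrite /q {1}(divn_eq (p ^ s) 8) q5 natrD natrM mulrC.
  (* This value comes from expanding (1 - c1)^2 = (2 c2 - 4 z)^2 with c1^2 = q = 8k + 5 and 2 c2^2 =
     -q + c1 a. *)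
  pose v := 2%:R + 3%:R * k%:R + 2%:R * (c2 * z - z ^+ 2).
  have vA : v \in Aint.
    have c2A : c2 \in Aint by rewrite c2z rpredB.
    have xA : c2 * z - z ^+ 2 \in Aint by rewrite rpredB ?rpredM ?rpredX.
    by rewrite /v !rpredD ?rpredM ?rpred_nat.
  have c1v : c1 * (a%:~R + 1) = 4%:R * v.
    apply: (mulfI two0).
    have : (1 - c1) ^+ 2 = (2%:R * c2 - 4%:R * z) ^+ 2.
      by congr (_ ^+ 2); rewrite -[4%:R * z](addKr 1) -zE; ring.
    rewrite sqrrB expr1n c1q => E1.
    transitivity (2%:R * (- q + c1 * a%:~R) - (1 - 1 * c1 *+ 2 + q) + (1 + 3%:R * q)); first
      by ring.
    by rewrite E1 -c2E qk /v; ring.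
  (* Squaring c1 (a + 1) = 4 v replaces the irrational c1 by the odd integer q, so 16 divides (a +
     1)^2. *)
  have E16 : ((p ^ s)%N%:Z * (a + 1) ^+ 2)%:~R = 16%:R * v ^+ 2 :> algC.
    rewrite rmorphM rmorphXn rmorphD /= -[(_%:Z)%:~R]/q -c1q -exprMn c1v exprMn; ring.
  have := Aint_dvdz (_ : (0 < 16)%N) _ E16; rewrite rpredX // => /(_ isT isT).
  rewrite dvdzE abszM abszX /= Gauss_dvdr; last first.
    by rewrite -[16%N]/(2 ^ 4)%N coprimeXl // coprime2n; move: q5; clear; lia.
  by rewrite -[16%N]/(4 ^ 2)%N dvdn_pexp2r //; clear; lia.
have aC : a = C1.
  have p_odd : odd p by move: p5; clear; lia.
  exact: (sum_two_squares_unique p_pr p_odd s0 ab CD pa pC a4 C4).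
have q0 : 0 <= q by apply: ler0n.
have hE : qpow q 1 2 = qpow q 1 4 ^+ 2.
  by rewrite -[2%N in LHS]/(2 ^ 1)%N -[4%N]/(2 ^ 2)%N !(@qpow_root q 2) // -exprM.
have hq : qpow q 1 2 ^+ 2 = q by rewrite /qpow expr1 rootCK.
set h := qpow q 1 2 in hE hq *; set f := qpow q 1 4 in hE *.
have sq (e : algC) y : 2%:R * y ^+ 2 = - q + e * h * a%:~R ->
    (2%:R * y) ^+ 2 = (f * 'i * sqrtC (2%:R * (h - e * C1%:~R))) ^+ 2.
  move=> E; rewrite exprMn [2%:R ^+ 2]expr2 -mulrA E !exprMn sqrtCK sqrCi -hE -hq aC; ring.
have sqm y := sq 1 y; rewrite !mul1r in sqm; have sqp y := sq (-1) y; rewrite !mulN1r opprK in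
  sqp.
have /eqP := c1q; rewrite -hq eqf_sqr => /orP[] /eqP c1h; rewrite c1h in c2E d2E *.
  rewrite addrC -[RHS]addrA; congr (_ + _); apply: exprDB_sqr_eq.
    by apply: sqp; rewrite d2E mulNr.
  by apply: sqm; rewrite c2E.
rewrite opprK -[RHS]addrA; congr (_ + _); apply: exprDB_sqr_eq.
  by apply: sqp; rewrite c2E.
by apply: sqm; rewrite d2E mulNr opprK.
Qed.

(** * The number of solutions *)

Theorem theorem4 (p s m n : nat) (F : finFieldType) (C D : nat -> int) :
  prime p -> (p %% 8 = 5)%N -> (1 <= s)%N ->
  #|F| = (p ^ s)%N ->
  (2 <= m)%N -> (2 ^ m %| (p ^ s).-1)%N -> ~~ (2 ^ m.+1 %| (p ^ s).-1)%N ->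
  (1 <= n)%N ->
  (forall r, (1 <= r <= m.-1)%N ->
     [/\ C r ^+ 2 + D r ^+ 2 = ((p ^ (s %/ 2 ^ r.-1))%N)%:Z,
         (C r == -1 %[mod 4])%Z & ~~ (p%:Z %| C r)%Z]) ->
  let q : algC := (p ^ s)%N%:R in
  let N : algC := (Nsol F n m)%:R in
  (m = 2%N ->
   N = q ^+ n.-1 + (q - 1) / (4%:R * q) *
     ( (- qpow q 1 2 + qpow q 1 4 * 'i * sqrtC (2%:R * (qpow q 1 2 + (C 1%N)%:~R))) ^+ n
     + (- qpow q 1 2 - qpow q 1 4 * 'i * sqrtC (2%:R * (qpow q 1 2 + (C 1%N)%:~R))) ^+ n
     + (qpow q 1 2 + qpow q 1 4 * 'i * sqrtC (2%:R * (qpow q 1 2 - (C 1%N)%:~R))) ^+ n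
     + (qpow q 1 2 - qpow q 1 4 * 'i * sqrtC (2%:R * (qpow q 1 2 - (C 1%N)%:~R))) ^+ n))
  /\
  ((3 <= m)%N ->
   let P : algC := - qpow q 1 2 +
       \sum_(2 <= r < m.-1) (2 ^ r.-1)%N%:R * (C r)%:~R * qpow q (2 ^ r.-1 - 1) (2 ^ r) in
   let A : algC := (2 ^ (m - 2))%N%:R * (C m.-1)%:~R * qpow q (2 ^ (m - 2) - 1) (2 ^ m.-1) in
   let B : algC := (2 ^ (m - 2))%N%:R * qpow q (2 ^ m.-1 - 1) (2 ^ m) * 'i in
   let Em : algC := sqrtC (2%:R * (qpow q 1 (2 ^ m.-1) - (C m.-1)%:~R)) in
   let Ep : algC := sqrtC (2%:R * (qpow q 1 (2 ^ m.-1) + (C m.-1)%:~R)) in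
   let T (t : nat) : algC := - qpow q 1 2
       + \sum_(2 <= r < t.+1) (2 ^ r.-1)%N%:R * (C r)%:~R * qpow q (2 ^ r.-1 - 1) (2 ^ r)
       - (2 ^ t)%N%:R * (C t.+1)%:~R * qpow q (2 ^ t - 1) (2 ^ t.+1) in
   let U (t : nat) : algC :=
       (2 ^ t.+1)%N%:R * (D t.+2)%:~R * qpow q (2 ^ t.+1 - 1) (2 ^ t.+2) in
   N = q ^+ n.-1 + (q - 1) / ((2 ^ m)%N%:R * q) *
     ( (2 ^ (m - 2))%N%:R *
         ((qpow q 1 2 + 2%:R * (D 2%N)%:~R * qpow q 1 4) ^+ n
          + (qpow q 1 2 - 2%:R * (D 2%N)%:~R * qpow q 1 4) ^+ n)
     + \sum_(1 <= t < m - 2) (2 ^ (m - t - 2))%N%:R *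
         ((T t + U t) ^+ n + (T t - U t) ^+ n)
     + (P + A + B * Em) ^+ n
     + (P + A - B * Em) ^+ n
     + (P - A + B * Ep) ^+ n
     + (P - A - B * Ep) ^+ n)).
Proof.
move=> p_pr p5 s_gt0 cardF m_ge2 m_dvd m_max n_gt0 CD q N.
have [c [d [a [b []]]]] := period_system p_pr p5 cardF m_ge2 m_dvd m_max.
rewrite -/q => -[c1q c2E d2E cdE] [ab pa] congE congK Nq.
have q0 : q != 0 by rewrite pnatr_eq0 -lt0n expn_gt0 prime_gt0.
have NE X k : (k != 0)%N -> q * N = q ^+ n + (q - 1) / k%:R * X ->
    N = q ^+ n.-1 + (q - 1) / (k%:R * q) * X.
  move=> k0 E; apply: (mulfI q0); rewrite E -{1}(prednK n_gt0) exprS mulrDr; congr (_ + _).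
  by field; rewrite q0 pnatr_eq0.
have pow2_neq0 : (2 ^ m != 0)%N by rewrite -lt0n expn_gt0.
split=> [m2|m3].
  have [|e1 e2 e3] := CD 1%N; first by rewrite m2.
  rewrite /= divn1 in e1.
  (* Powers of [p] are 1 or 5 mod 8, and the maximality of m = 2 excludes 1. *)
  have q5 : (p ^ s %% 8 = 5)%N.
    have pX k : (p ^ k %% 8 = 1 \/ p ^ k %% 8 = 5)%N.
      elim: k => [|k [IHk|IHk]]; first by left.
      - by right; rewrite expnS -modnMm p5 IHk.
      - by left; rewrite expnS -modnMm p5 IHk.
    by move: m_max; rewrite m2; case: (pX s) => //; clear; lia.
  apply: (NE _ 4%N) => //.
  rewrite -(@quartic_bracket p s _ _ a b (c 1%N) (c 2%N) (d 2%N) n p_pr p5 s_gt0 q5 e1 e2 e3) //.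
  - have := Nq n; rewrite m2 /= !big_nat1 big_geq // !mul1r !sub0r mulN1r.
    by rewrite /N m2.
  - by rewrite c2E m2 subnn expr1 mulN1r.
  - by rewrite d2E m2 subnn expr1 mulN1r.
  - by move=> e /congK; rewrite m2 /= big_nat1 mul1r.
have s_dvd := two_adic_exponent p5 s_gt0 m_dvd.
move=> P A B Em Ep T U; apply: NE => //.
have sgE r : (r < m)%N -> (-1) ^+ (2 ^ (m - r)) = 1 :> algC.
  by move=> rm; rewrite -signr_odd oddX subn_eq0 leqNgt rm.
rewrite sgE ?mul1r // in c2E d2E.
have c_rec r : (2 < r < m)%N -> 2%:R * c r ^+ 2 = q + c 1%N * c r.-1.
  case/andP=> r2 rm; have [|-> _] := cdE r; first by rewrite r2 ltnW.
  by rewrite sgE // mul1r.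
have d_rec r : (2 < r < m)%N -> 2%:R * d r ^+ 2 = q - c 1%N * c r.-1.
  case/andP=> r2 rm; have [|_ ->] := cdE r; first by rewrite r2 ltnW.
  by rewrite sgE // mul1r.
have [|ct dt] := cdE m; first by rewrite m3 leqnn.
rewrite subnn expr1 !mulN1r in ct dt.
(* Averaging the two congruences with opposite signs eliminates d_(t+2), at the cost of one factor 2
   in the modulus. *)
have c_cong t : (t + 2 <= m)%N -> exists2 z, z \in Aint &
    \sum_(1 <= r < t.+1) (2 ^ r.-1)%N%:R * c r - (2 ^ t)%N%:R * c t.+1 = 1 + (2 ^ m.-1)%N%:R * z.
  move=> tm; have [z zA zE] := congE 1 t (expr1n _ _) tm.
  have [y yA yE] := congE (-1) t (etrans (sqrrN _) (expr1n _ _)) tm.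
  exists (z + y); first exact: rpredD.
  apply: (mulfI (_ : (2%:R : algC) != 0)); first by rewrite pnatr_eq0.
  transitivity ((1 + (2 ^ m)%:R * z) + (1 + (2 ^ m)%:R * y)); first by rewrite -zE -yE; ring.
  by rewrite -{1 2}(prednK (ltnW m_ge2)) expnS natrM; ring.
rewrite /N Nq; congr (_ + _ * _).
exact: (bracket_value p_pr p5 s_gt0 m3 s_dvd CD c1q c2E d2E c_rec d_rec ab pa c_cong ct dt n).
Qed.
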